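(* Let $S^{(-)}=S^{(-)}_{N,p,q,r}$ be the Inoue surface, let $\omega=-i(\theta^1\wedge\overline{\theta^1}+\theta^2\wedge\overline{\theta^2})$, with $\theta^1=\frac{dw}{w_2}$ and $\theta^2=\frac{z_2}{w_2}dw-dz$, be its locally conformally Kähler (l.c.k.) structure, and let $L$ be the corresponding flat line bundle to $\omega$. Let $\{L_s\}$ be the deformations of flat line bundles with $L_0=L$ given by the classes $[s\eta]\in H^1(S^{(-)},\mathbb{R})$, where $\eta=\frac{dw_2}{w_2}$. Then $S^{(-)}$ does not admit a smooth family of l.c.k. structures $\{\omega_s\}$ such that $L_s$ is the corresponding flat line bundle to $\omega_s$ (for all small real $s$).
   Context: An l.c.k. structure on a complex manifold is the fundamental $2$-form $\omega$ of a Hermitian metric such that $d\omega=\eta'\wedge\omega$ for some $d$-closed real $1$-form $\eta'$ (the Lee form). (The sign convention for fundamental forms is such that the $\omega$ in the claim is positive.) The corresponding flat line bundle to $\omega$ is the real flat line bundle with locally constant transition functions $e^{-\lambda_{ij}}$ where, on a suitable open cover $\{U_i\}$, $\eta'|_{U_i}=df_i$ and $\lambda_{ij}=f_i-f_j$ is constant on $U_i\cap U_j$ (flat line bundles are considered up to isomorphism). With $d_L$ the induced exterior derivative on $L$-valued forms, the deformation $L_s$ given by $s\eta$ is the flat line bundle whose flat sections are the sections $\sigma$ of $L$ with $(d_L+s\eta)\sigma=0$. Inoue surface $S^{(-)}_{N,p,q,r}$: let $\mathbb{H}$ be the upper half plane with coordinate $w=w_1+\sqrt{-1}\,w_2$ and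 let $z=z_1+\sqrt{-1}\,z_2$ be the coordinate of $\mathbb{C}$. Let $N=(n_{ij})\in GL(2,\mathbb{Z})$ with $\det N=-1$ have real eigenvalues $\alpha>1$ and $-1/\alpha$, with real eigenvectors $(a_1,a_2)$ and $(b_1,b_2)$ for $\alpha$ and $-1/\alpha$ respectively; let $p,q,r$ be integers with $r\neq0$, and let $(c_1,c_2)$ be the real solution of $-(c_1,c_2)=(c_1,c_2)N^{t}+(e_1,e_2)+\frac{b_1a_2-b_2a_1}{r}(p,q)$, where $N^t$ is the transpose and $e_i=\frac12 n_{i1}(n_{i1}-1)a_1b_1+\frac12 n_{i2}(n_{i2}-1)a_2b_2+n_{i1}n_{i2}b_1a_2$ for $i=1,2$. Then $S^{(-)}_{N,p,q,r}$ is the quotient of $\mathbb{H}\times\mathbb{C}$ by the group $G^{(-)}_{N,p,q,r}$ generated by $\phi_0(w,z)=(\alpha w,-z)$, $\phi_i(w,z)=(w+a_i,\,z+b_iw+c_i)$ for $i=1,2$, and $\phi_3(w,z)=(w,\,z+\frac{b_1a_2-b_2a_1}{r})$, which acts freely and properly discontinuously with compact quotient. The form $\theta^1$ is invariant, $\theta^2$ is invariant under $\phi_1,\phi_2,\phi_3$ and $\phi_0^*\theta^2=-\theta^2$, so $\omega$ descends to $S^{(-)}$; its Lee form is $\frac{dw_2}{w_2}$. *)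

(* Defs.v *)
From HB Require Import structures.
From mathcomp Require Import all_boot all_order all_algebra.
From mathcomp Require Import all_classical all_reals all_analysis.
From mathcomp.real_closed Require Import complex.
From mathcomp Require Import ring.

Set Implicit Arguments.
Unset Strict Implicit.
Unset Printing Implicit Defensive.

Import Order.TTheory GRing.Theory Num.Theory.
Import numFieldNormedType.Exports.

Local Open Scope classical_set_scope.
Local Open Scope ring_scope.
Local Open Scope complex_scope.
Local Open Scope quotient_scope.

Definition partial (R : realType) (n : nat) (i : 'I_n) (f : 'rV[R]_n -> R)
    (x : 'rV[R]_n) : R :=
  'D_(delta_mx 0 i) f x.

Fixpoint Ck_on (R : realType) (n k : nat) (U : set 'rV[R]_n)
    (f : 'rV[R]_n -> R) : Prop :=
  (forall x, U x -> {for x, continuous f}) /\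
  match k with
  | 0 => True
  | k'.+1 => forall i : 'I_n,
      (forall x, U x -> derivable f x (delta_mx 0 i)) /\
      Ck_on k' U (partial i f)
  end.

Definition smooth_on (R : realType) (n : nat) (U : set 'rV[R]_n)
    (f : 'rV[R]_n -> R) : Prop :=
  forall k, Ck_on k U f.

(* The point (w, z) of C x C is the row vector (w_1, w_2, z_1, z_2). *)
Notation point R := 'rV[R]_4.

Definition mkpoint (R : realType) (w z : R[i]) : point R :=
  \row_(k < 4) [:: complex.Re w; complex.Im w; complex.Re z; complex.Im z]`_k.

Definition wcoord (R : realType) (x : point R) : R[i] := x 0 0 +i* x 0 1.
Definition zcoord (R : realType) (x : point R) : R[i] := x 0 2 +i* x 0 3.

Definition complex_structure (R : realType) (v : point R) : point R :=
  mkpoint ('i * wcoord v) ('i * zcoord v).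

Lemma wcoordK (R : realType) (w z : R[i]) : wcoord (mkpoint w z) = w.
Proof. by case: w => u v; rewrite /wcoord !mxE. Qed.

Lemma zcoordK (R : realType) (w z : R[i]) : zcoord (mkpoint w z) = z.
Proof. by case: z => u v; rewrite /zcoord !mxE. Qed.

Lemma mkpointK (R : realType) (x : point R) : mkpoint (wcoord x) (zcoord x) = x.
Proof.
apply/rowP => -[[|[|[|[|//]]]] ?]; rewrite !mxE /=; congr (x _ _);
  exact/val_inj.
Qed.

Definition HC (R : realType) : set (point R) := [set x | 0 < complex.Im (wcoord x)].

(* A 1-form is its row of coefficients, a covariant 2-tensor T (a 2-form or a
   metric) its matrix of coefficients T(e_i, e_j), and a 3-form the family of its
   values on the triples (e_i, e_j, e_k). Only the values on [HC] matter. *)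
Notation form1 R := (point R -> 'rV[R]_4).
Notation tensor2 R := (point R -> 'M[R]_4).
Notation form3 R := (point R -> 'I_4 -> 'I_4 -> 'I_4 -> R).

Definition bilin (R : realType) (T : 'M[R]_4) (u v : point R) : R :=
  (u *m T *m v^T) 0 0.

Definition wedge1 (K : comPzRingType) (a b : 'rV[K]_4) : 'M[K]_4 :=
  a^T *m b - b^T *m a.

Definition wedge12 (R : realType) (a : form1 R) (o : tensor2 R) : form3 R :=
  fun x i j k =>
    a x 0 i * o x j k + a x 0 j * o x k i + a x 0 k * o x i j.

Definition ext_d1 (R : realType) (a : form1 R) : tensor2 R := fun x =>
  \matrix_(i, j) (partial i (fun y => a y 0 j) x - partial j (fun y => a y 0 i) x).

Definition ext_d2 (R : realType) (o : tensor2 R) : form3 R :=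
  fun x i j k =>
    partial i (fun y => o y j k) x + partial j (fun y => o y k i) x
    + partial k (fun y => o y i j) x.

Definition smooth_form1 (R : realType) (a : form1 R) : Prop :=
  forall i, smooth_on (@HC R) (fun x => a x 0 i).

Definition smooth_tensor2 (R : realType) (o : tensor2 R) : Prop :=
  forall i j, smooth_on (@HC R) (fun x => o x i j).

Definition pullback1 (R : realType) (phi : point R -> point R) (a : form1 R) :
    form1 R :=
  fun x => a (phi x) *m (jacobian phi x)^T.

Definition pullback2 (R : realType) (phi : point R -> point R) (o : tensor2 R) :
    tensor2 R :=
  fun x => jacobian phi x *m o (phi x) *m (jacobian phi x)^T.

(* [a], [b] and [c] are the pairs (a_1, a_2), (b_1, b_2) and (c_1, c_2). For
   a row vector [v], [v *m N^T = l *: v] says that N v^t = l v^t. *)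
Definition inoue_e (R : realType) (N : 'M[int]_2) (a b : 'rV[R]_2) : 'rV[R]_2 :=
  let n (i j : 'I_2) : R := (N i j)%:~R in
  \row_(i < 2)
    (2^-1 * n i 0 * (n i 0 - 1) * a 0 0 * b 0 0
     + 2^-1 * n i 1 * (n i 1 - 1) * a 0 1 * b 0 1
     + n i 0 * n i 1 * b 0 0 * a 0 1).

Definition inoue_step (R : realType) (r : int) (a b : 'rV[R]_2) : R :=
  (b 0 0 * a 0 1 - b 0 1 * a 0 0) / r%:~R.

Record inoue_data (R : realType) := InoueData {
  iN : 'M[int]_2;
  ip : int;
  iq : int;
  ir : int;
  ialpha : R;
  ia : 'rV[R]_2;
  ib : 'rV[R]_2;
  ic : 'rV[R]_2;
  iN_det : \det iN = -1;
  ir_neq0 : ir != 0;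
  ialpha_gt1 : 1 < ialpha;
  ia_neq0 : ia != 0;
  ib_neq0 : ib != 0;
  ia_eigen : ia *m (map_mx intr iN)^T = ialpha *: ia;
  ib_eigen : ib *m (map_mx intr iN)^T = - ialpha^-1 *: ib;
  ic_def : - ic = ic *m (map_mx intr iN)^T + inoue_e iN ia ib
                  + inoue_step ir ia ib *:
                      \row_(i < 2) [:: ip%:~R; iq%:~R]`_i
}.

Section InoueSurface.
Variables (R : realType) (D : inoue_data R).

Definition phi0 (x : point R) : point R :=
  mkpoint ((ialpha D)%:C * wcoord x) (- zcoord x).

Definition phi (i : 'I_2) (x : point R) : point R :=
  mkpoint (wcoord x + (ia D 0 i)%:C)
          (zcoord x + (ib D 0 i)%:C * wcoord x + (ic D 0 i)%:C).

Definition phi3 (x : point R) : point R :=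
  mkpoint (wcoord x) (zcoord x + (inoue_step (ir D) (ia D) (ib D))%:C).

(* A group of transformations of C x C, all of which preserve [HC]. *)
Inductive inoue_group : (point R -> point R) -> Prop :=
| inoue_group_phi0 : inoue_group phi0
| inoue_group_phi i : inoue_group (phi i)
| inoue_group_phi3 : inoue_group phi3
| inoue_group_id : inoue_group id
| inoue_group_comp g h : inoue_group g -> inoue_group h -> inoue_group (g \o h)
| inoue_group_inv g h : inoue_group g -> cancel g h -> cancel h g ->
    inoue_group h.

Lemma inoue_group_has_inv g : inoue_group g ->
  exists2 h, inoue_group h & cancel g h.
Proof.
have al0 : (ialpha D)%:C != 0.
  by rewrite (inj_eq (@complexI _)) gt_eqF// (lt_trans ltr01)// ialpha_gt1.
elim=> [|i||||].
- exists (fun x => mkpoint ((ialpha D)%:C^-1 * wcoord x) (- zcoord x)).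
    apply: inoue_group_inv inoue_group_phi0 _ _ => x;
      by rewrite /phi0 wcoordK zcoordK mulrA ?(mulVf, mulfV) ?mul1r ?opprK ?mkpointK.
  by move=> x; rewrite /phi0 wcoordK zcoordK mulKf// opprK mkpointK.
- pose h x := mkpoint (wcoord x - (ia D 0 i)%:C)
    (zcoord x - (ic D 0 i)%:C - (ib D 0 i)%:C * (wcoord x - (ia D 0 i)%:C)).
  have ph : cancel (phi i) h.
    by move=> x; rewrite /h /phi wcoordK zcoordK !addrK mkpointK.
  exists h => //; apply: inoue_group_inv (inoue_group_phi i) ph _ => x.
  by rewrite /h /phi wcoordK zcoordK !subrK mkpointK.
- pose h x := mkpoint (wcoord x)
    (zcoord x - (inoue_step (ir D) (ia D) (ib D))%:C).
  have ph : cancel phi3 h.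
    by move=> x; rewrite /h /phi3 wcoordK zcoordK addrK mkpointK.
  exists h => //; apply: inoue_group_inv inoue_group_phi3 ph _ => x.
  by rewrite /h /phi3 wcoordK zcoordK subrK mkpointK.
- by exists id => //; exact: inoue_group_id.
- move=> g1 g2 _ [h1 Gh1 gh1] _ [h2 Gh2 gh2]; exists (h2 \o h1).
    exact: inoue_group_comp.
  exact: can_comp.
- by move=> f h Gf _ fh hf; exists f.
Qed.

Definition inoue_rel (x y : @HC R) : bool :=
  `[< exists2 g, inoue_group g & set_val y = g (set_val x) >].

Lemma inoue_rel_refl : reflexive inoue_rel.
Proof. by move=> x; apply/asboolP; exists id => //; exact: inoue_group_id. Qed.

Lemma inoue_rel_sym : symmetric inoue_rel.
Proof.
have sub x y : inoue_rel x y -> inoue_rel y x.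
  move=> /asboolP[g Gg xy]; apply/asboolP.
  have [h Gh gh] := inoue_group_has_inv Gg.
  by exists h => //; rewrite xy gh.
by move=> x y; apply/idP/idP; exact: sub.
Qed.

Lemma inoue_rel_trans : transitive inoue_rel.
Proof.
move=> y x z /asboolP[g Gg xy] /asboolP[h Gh yz]; apply/asboolP.
by exists (h \o g); [exact: inoue_group_comp | rewrite yz xy].
Qed.

Definition inoue_equiv :=
  EquivRel inoue_rel inoue_rel_refl inoue_rel_sym inoue_rel_trans.

Definition inoue_surface := {eq_quot inoue_equiv}.

HB.instance Definition _ :=
  Topological.copy inoue_surface (quotient_topology inoue_surface).
HB.instance Definition _ := Quotient.on inoue_surface.

(* A function on the quotient is differentiated through its pullback to [HC],
   extended by 0 to R^4; a form on the quotient is a form on [HC] invariant under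
   the group. *)
Definition lift_fun (f : inoue_surface -> R) (x : point R) : R :=
  oapp (fun y : @HC R => f (\pi_inoue_surface y)) 0 (insub x).

Definition lift_set (U : set inoue_surface) : set (point R) :=
  set_val @` (\pi_inoue_surface @^-1` U).

Definition smooth_surface_fun (U : set inoue_surface) (f : inoue_surface -> R)
    : Prop :=
  smooth_on (lift_set U) (lift_fun f).

Definition surface_form1 (a : form1 R) : Prop :=
  smooth_form1 a /\
  forall g, inoue_group g -> forall x, @HC R x -> pullback1 g a x = a x.

Definition surface_tensor2 (o : tensor2 R) : Prop :=
  smooth_tensor2 o /\
  forall g, inoue_group g -> forall x, @HC R x -> pullback2 g o x = o x.

Definition hermitian_metric (g : tensor2 R) : Prop :=
  surface_tensor2 g /\
  forall x, @HC R x ->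
    [/\ forall u v, bilin (g x) u v = bilin (g x) v u,
        forall u, u != 0 -> 0 < bilin (g x) u u &
        forall u v,
          bilin (g x) (complex_structure u) (complex_structure v)
          = bilin (g x) u v].

(* With omega(X, Y) = g(X, JY), the form -i theta /\ conj theta is semi-positive
   for every (1,0)-form theta. *)
Definition fundamental_form (o g : tensor2 R) : Prop :=
  forall x, @HC R x -> forall u v,
    bilin (o x) u v = bilin (g x) u (complex_structure v).

Definition lee_form (o : tensor2 R) (a : form1 R) : Prop :=
  [/\ surface_form1 a,
      forall x, @HC R x -> ext_d1 a x = 0 &
      forall x, @HC R x -> forall i j k, ext_d2 o x i j k = wedge12 a o x i j k].

Definition lck_structure (o : tensor2 R) : Prop :=
  [/\ surface_tensor2 o,
      exists2 g, hermitian_metric g & fundamental_form o g &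
      exists a, lee_form o a].

End InoueSurface.

Definition locally_constant_on (X : topologicalType) (T : Type) (U : set X)
    (f : X -> T) : Prop :=
  forall x, U x -> \forall y \near x, U y -> f y = f x.

(* Sections are families (sigma_i) with sigma_i = fl_trans i j * sigma_j. *)
Record flat_line_bundle (R : realType) (X : topologicalType) := FlatLineBundle {
  fl_index : Type;
  fl_open : fl_index -> set X;
  fl_trans : fl_index -> fl_index -> X -> R;
  fl_openP : forall i, open (fl_open i);
  fl_cover : forall x, exists i, fl_open i x;
  fl_trans_neq0 : forall i j x, fl_open i x -> fl_open j x ->
    fl_trans i j x != 0;
  fl_trans_lc : forall i j,
    locally_constant_on (fl_open i `&` fl_open j) (fl_trans i j);
  fl_cocycle : forall i j k x, fl_open i x -> fl_open j x -> fl_open k x ->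
    fl_trans i j x * fl_trans j k x = fl_trans i k x
}.

(* [k i a] is the matrix, over the overlap of the i-th open set for [L] and the
   a-th one for [M], of a fibrewise isomorphism from [M] to [L]. *)
Definition bundle_iso (R : realType) (X : topologicalType)
    (L M : flat_line_bundle R X) (k : fl_index L -> fl_index M -> X -> R)
    : Prop :=
  (forall i a x, fl_open i x -> fl_open a x -> k i a x != 0) /\
  (forall i j a b x, fl_open i x -> fl_open j x -> fl_open a x -> fl_open b x ->
    k i a x * fl_trans a b x = fl_trans i j x * k j b x).

Definition flat_isomorphic (R : realType) (X : topologicalType)
    (L M : flat_line_bundle R X) : Prop :=
  exists2 k : fl_index L -> fl_index M -> X -> R,
    bundle_iso k &
    forall i a, locally_constant_on (fl_open i `&` fl_open a) (k i a).

Section FlatBundlesOnInoue.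
Variables (R : realType) (D : inoue_data R).
Local Notation S := (inoue_surface D).
Local Notation bundle := (flat_line_bundle R S).

Definition section_on (L : bundle) (W : set S) (s : fl_index L -> S -> R)
    : Prop :=
  (forall i, smooth_surface_fun (W `&` fl_open i) (s i)) /\
  (forall i j x, W x -> fl_open i x -> fl_open j x ->
    s i x = fl_trans i j x * s j x).

(* (d_L + a) s = 0 over W, where (d_L s)_i = d s_i *)
Definition twisted_parallel (L : bundle) (a : form1 R) (W : set S)
    (s : fl_index L -> S -> R) : Prop :=
  forall i x, lift_set (W `&` fl_open i) x -> forall k,
    partial k (lift_fun (s i)) x + a x 0 k * lift_fun (s i) x = 0.

Definition flat_section (L : bundle) (W : set S) (s : fl_index L -> S -> R)
    : Prop :=
  forall i, locally_constant_on (W `&` fl_open i) (s i).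

(* [M] is the smooth line bundle [L] equipped with the flat structure whose
   flat sections are the sections annihilated by d_L + a. *)
Definition deformation (L : bundle) (a : form1 R) (M : bundle) : Prop :=
  exists k : fl_index L -> fl_index M -> S -> R,
    [/\ bundle_iso k,
        forall i b, smooth_surface_fun (fl_open i `&` fl_open b) (k i b) &
        forall (W : set S) t s, open W -> section_on W t -> section_on W s ->
          (forall i b x, W x -> fl_open i x -> fl_open b x ->
            s i x = k i b x * t b x) ->
          (@flat_section M W t <-> @twisted_parallel L a W s)].

(* The transition functions are e^{-(f_i - f_j)}, where a = d f_i and f_i - f_j
   is constant on the overlaps. *)
Definition bundle_from_primitives (a : form1 R) (M : bundle) : Prop :=
  exists f : fl_index M -> S -> R,
    (forall i,
      smooth_surface_fun (fl_open i) (f i) /\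
      forall x, lift_set (fl_open i) x -> forall k,
        partial k (lift_fun (f i)) x = a x 0 k) /\
    (forall i j, exists l : R, forall x, fl_open i x -> fl_open j x ->
      f i x - f j x = l /\ fl_trans i j x = expR (- l)).

Definition corresponding_bundle (o : tensor2 R) (L : bundle) : Prop :=
  exists a M, [/\ lee_form D o a, bundle_from_primitives a M &
                  flat_isomorphic L M].

End FlatBundlesOnInoue.

Section ClaimForms.
Variable R : realType.

Definition dw : 'rV[R[i]]_4 := \row_k wcoord (delta_mx 0 k).
Definition dz : 'rV[R[i]]_4 := \row_k zcoord (delta_mx 0 k).
Definition dw2 : 'rV[R]_4 := \row_k complex.Im (wcoord (delta_mx 0 k)).

Definition theta1 (x : point R) : 'rV[R[i]]_4 :=
  (complex.Im (wcoord x))%:C^-1 *: dw.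

Definition theta2 (x : point R) : 'rV[R[i]]_4 :=
  (complex.Im (zcoord x) / complex.Im (wcoord x))%:C *: dw - dz.

Definition omega_complex (x : point R) : 'M[R[i]]_4 :=
  - 'i *: (wedge1 (theta1 x) (map_mx conjc (theta1 x))
           + wedge1 (theta2 x) (map_mx conjc (theta2 x))).

Definition omega : tensor2 R := fun x => map_mx (@complex.Re R) (omega_complex x).

Lemma omega_complexE (x : point R) :
  omega_complex x = map_mx (real_complex R) (omega x).
Proof.
apply/matrixP => i j; rewrite [RHS]mxE [omega x i j]mxE.
suff: (omega_complex x i j)^*%C = omega_complex x i j.
  case: (omega_complex x i j) => u v [] /eqP; rewrite eq_sym -subr_eq0 opprK.
  by rewrite -mulr2n mulrn_eq0 /= => /eqP ->.
rewrite /omega_complex !mxE !big_ord1 !mxE.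
set t := theta1 x 0 i; set t' := theta1 x 0 j.
set u := theta2 x 0 i; set u' := theta2 x 0 j.
by case: t t' u u' => [? ?] [? ?] [? ?] [? ?]; congr (_ +i* _) => /=; ring.
Qed.

Definition eta : form1 R := fun x => (complex.Im (wcoord x))^-1 *: dw2.

End ClaimForms.

Definition form1_scale (R : realType) (s : R) (a : form1 R) : form1 R :=
  fun x => s *: a x.

(* Joint smoothness in (s, x), for |s| < e and x in [HC]. *)
Definition smooth_family (R : realType) (e : R) (o : R -> tensor2 R) : Prop :=
  forall i j,
    smooth_on [set y : 'rV[R]_(1 + 4) | `|lsubmx y 0 0| < e /\ @HC R (rsubmx y)]
      (fun y => o (lsubmx y 0 0) (rsubmx y) i j).

(* Main.v *)
Require Import Defs.
From mathcomp Require Import all_boot all_order all_algebra.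
From mathcomp Require Import all_classical all_reals all_analysis.
From mathcomp.real_closed Require Import complex.
From mathcomp Require Import ring lra.

Set Implicit Arguments.
Unset Strict Implicit.
Unset Printing Implicit Defensive.

Import Order.TTheory GRing.Theory Num.Theory.
Import numFieldNormedType.Exports.
Local Open Scope classical_set_scope.
Local Open Scope ring_scope.

(** A flat bundle remembers the cohomology class of the Lee form. If [L_s]
    corresponds to [omega_s], whose Lee form is [a], then comparing the bundle of
    [omega], the bundle [L] with connection d_L + s eta, and the bundle of [omega_s]
    produces a positive function [h] on the surface with
    dh / h = (1 - s) eta - a ([conformal_factor_derive]; that the Lee
    form of [omega] can only be [eta] is [lee_form_omega]). The form
    Omega = h omega_s on the universal cover is then invariant, positive, and
    satisfies d Omega = l eta /\ Omega with l = 1 - s. For s > 0 this is impossible: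
    [twisted_closed_ge1] shows that 1 <= l.

    The reason is Stokes' theorem. The form e1 = dw1 / w2 is invariant and
    de1 = e1 /\ eta, so d(Omega /\ e1) = (1 - l) Omega /\ e1 /\ eta. The integral of the
    left-hand side over the compact surface vanishes, whereas Omega /\ e1 /\ eta has
    a constant sign, its coefficient being that of dz1 /\ dz2 in Omega.

    Integration over the quotient is replaced by an elementary computation on the
    slice w1 = 0 of the universal cover. There, the component of
    d Omega = l eta /\ Omega on (d/dw2, d/dz1, d/dz2) reads
      d_{w2} Omega_23 + d_{z1} Omega_31 + d_{z2} Omega_12 = (l / w2) Omega_23,
    coordinates being numbered 0, 1, 2, 3 in the order w1, w2, z1, z2. The vector
    field on the left is periodic in w2 (multiplicatively, under the square of
    phi0) and in z1 (under phi3). Invariance under [phi 0] and [phi 1] only gives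
    Omega_12 = B + (z2 / w2) Omega_23 with B and Omega_23 bounded
    ([invariant_bounded]), so the flux in the direction of z2 is not bounded; but it
    becomes so after division by z2, that is, in the coordinate v = log z2, and this
    changes l into l - 1 in the equation, up to a term that decays like e^{-v}
    ([divergence_log]). Thus if l < 1, the divergence is bounded away from 0 with
    a constant sign while the flux through the boundary of a box of length T in
    the direction of v is bounded, independently of T, per unit area of the two
    other directions. The divergence inequality [box_divergence] rules this out. *)

(** * A divergence inequality on boxes *)

Section BoxDivergence.
Variable R : realType.

Definition node (a l : R) (N i : nat) : R := a + l / N%:R * i%:R.

Lemma node_itv (a l : R) (N i : nat) : 0 < l -> (i < N)%N ->
  a <= node a l N i <= a + l.
Proof.
move=> l0 iN; have N0 : 0 < N%:R :> R by rewrite ltr0n (leq_ltn_trans _ iN).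
rewrite /node lerDl lerD2l; apply/andP; split.
  by apply: mulr_ge0 => //; apply: divr_ge0 => //; exact: ltW.
by rewrite mulrAC ler_pdivrMr// ler_pM2l// ler_nat ltnW.
Qed.

(** A discrete fundamental theorem of calculus: the increments of [f] along the
    nodes telescope, so a bound on the total increment bounds the sum of the
    approximate derivatives. Sums stand in for integrals in the next lemma. *)
Lemma riemann_sum_le (a l e D : R) (N : nat) (f g : R -> R) :
  0 < l -> (0 < N)%N ->
  (forall i, (i < N)%N -> let t := node a l N i in
     `|f (t + l / N%:R) - f t - l / N%:R * g t| <= e * (l / N%:R)) ->
  `|f (a + l) - f a| <= D ->
  \sum_(i < N) g (node a l N i) <= N%:R * (D / l + e).
Proof.
move=> l0 N0 fg fD; have n0 : 0 < N%:R :> R by rewrite ltr0n.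
set h := l / N%:R in fg *; have h0 : 0 < h by rewrite divr_gt0.
have nodeS i : node a l N i + h = node a l N i.+1.
  by rewrite /node -/h -addrA -[in RHS]natr1 mulrDr mulr1.
have tele : \sum_(i < N) (f (node a l N i.+1) - f (node a l N i)) = f (a + l) - f a.
  rewrite -(big_mkord xpredT (fun i => f (node a l N i.+1) - f (node a l N i))).
  rewrite telescope_sumr// /node mulr0 addr0 -/h.
  by congr (f (_ + _) - _); rewrite /h divfK// gt_eqF.
have : h * \sum_(i < N) g (node a l N i) <= D + N%:R * (e * h).
  rewrite mulr_sumr.
  have -> : \sum_(i < N) h * g (node a l N i) =
      (f (a + l) - f a) - \sum_(i < N)
        (f (node a l N i + h) - f (node a l N i) - h * g (node a l N i)).
    rewrite -tele -sumrB; apply: eq_bigr => i _.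
    by rewrite -nodeS opprB addrC subrK.
  rewrite lerD//; first exact: le_trans (ler_norm _) fD.
  rewrite -sumrN mulr_natl -[X in _ *+ X]card_ord -sumr_const ler_sum// => i _.
  by rewrite (le_trans (ler_norm _))// normrN; apply: fg.
rewrite -ler_pdivlMl// => /le_trans; apply.
rewrite /h le_eqVlt; apply/orP; left; apply/eqP; field.
by rewrite !gt_eqF.
Qed.

(** Gauss' theorem as an inequality. If the flux difference between opposite faces
    is at most [D_i] in the i-th direction, then the mean divergence is at most
    the sum of the [D_i / l_i]. Cutting the box into N^3 cells, the divergence at
    the corner of a cell is, up to [e], the sum of the three difference quotients
    of the cell; each difference quotient telescopes along its own direction. *)
Lemma box_divergence (F1 F2 F3 G1 G2 G3 : R -> R -> R -> R)
    (a1 a2 a3 l1 l2 l3 D1 D2 D3 c : R) :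
  0 < l1 -> 0 < l2 -> 0 < l3 ->
  let box x y z := [&& a1 <= x <= a1 + l1, a2 <= y <= a2 + l2
                     & a3 <= z <= a3 + l3] in
  (forall e, 0 < e -> \forall h \near (0 : R), forall x y z, box x y z ->
    [/\ `|F1 (x + h) y z - F1 x y z - h * G1 x y z| <= e * `|h|,
        `|F2 x (y + h) z - F2 x y z - h * G2 x y z| <= e * `|h| &
        `|F3 x y (z + h) - F3 x y z - h * G3 x y z| <= e * `|h|]) ->
  (forall x y z, box x y z ->
    [/\ `|F1 (a1 + l1) y z - F1 a1 y z| <= D1,
        `|F2 x (a2 + l2) z - F2 x a2 z| <= D2 &
        `|F3 x y (a3 + l3) - F3 x y a3| <= D3]) ->
  (forall x y z, box x y z -> c <= G1 x y z + G2 x y z + G3 x y z) ->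
  c <= D1 / l1 + D2 / l2 + D3 / l3.
Proof.
move=> l10 l20 l30 box diff flux div; apply/ler_addgt0Pr => e e0.
have e30 : 0 < e / 3 by rewrite divr_gt0.
have /nbhs_ballP[d /= d0 hd] := diff _ e30.
(* the mesh is below [d] in all three directions *)
pose N := (Num.truncn ((l1 + l2 + l3) / d)).+1.
have n0 : 0 < N%:R :> R by rewrite ltr0n.
have small l : 0 < l -> l <= l1 + l2 + l3 -> l / N%:R < d.
  move=> l0 ll; rewrite ltr_pdivrMr// mulrC -ltr_pdivrMr//.
  by rewrite (le_lt_trans _ (truncnS_gt _))// ler_pM2r ?invr_gt0.
have ballh l : 0 < l -> l <= l1 + l2 + l3 -> ball 0 d (l / N%:R).
  move=> l0 ll; rewrite -ball_normE /= sub0r normrN gtr0_norm ?small//.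
  by rewrite divr_gt0.
have hpos l : 0 < l -> `|l / N%:R| = l / N%:R.
  by move=> l0; rewrite gtr0_norm// divr_gt0.
pose x i := node a1 l1 N i; pose y i := node a2 l2 N i; pose z i := node a3 l3 N i.
have boxn (i j k : 'I_N) : box (x i) (y j) (z k) by rewrite /box !node_itv.
have N0 : (0 < N)%N by [].
have s1 : \sum_(j < N) \sum_(k < N) \sum_(i < N) G1 (x i) (y j) (z k)
    <= \sum_(j < N) \sum_(k < N) N%:R * (D1 / l1 + e / 3).
  apply: ler_sum => j _; apply: ler_sum => k _.
  apply: (@riemann_sum_le a1 l1 _ _ N (fun t => F1 t (y j) (z k))
    (fun t => G1 t (y j) (z k))) => //.
    move=> i iN /=.
    have [+ _ _] := hd _ (ballh l1 l10 ltac:(lra)) _ _ _ (boxn (Ordinal iN) j k).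
    by rewrite hpos.
  by have [] := flux _ _ _ (boxn ord0 j k).
have s2 : \sum_(i < N) \sum_(k < N) \sum_(j < N) G2 (x i) (y j) (z k)
    <= \sum_(i < N) \sum_(k < N) N%:R * (D2 / l2 + e / 3).
  apply: ler_sum => i _; apply: ler_sum => k _.
  apply: (@riemann_sum_le a2 l2 _ _ N (fun t => F2 (x i) t (z k))
    (fun t => G2 (x i) t (z k))) => //.
    move=> j jN /=.
    have [_ + _] := hd _ (ballh l2 l20 ltac:(lra)) _ _ _ (boxn i (Ordinal jN) k).
    by rewrite hpos.
  by have [] := flux _ _ _ (boxn i ord0 k).
have s3 : \sum_(i < N) \sum_(j < N) \sum_(k < N) G3 (x i) (y j) (z k)
    <= \sum_(i < N) \sum_(j < N) N%:R * (D3 / l3 + e / 3).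
  apply: ler_sum => i _; apply: ler_sum => j _.
  apply: (@riemann_sum_le a3 l3 _ _ N (fun t => F3 (x i) (y j) t)
    (fun t => G3 (x i) (y j) t)) => //.
    move=> k kN /=.
    have [_ _] := hd _ (ballh l3 l30 ltac:(lra)) _ _ _ (boxn i j (Ordinal kN)).
    by rewrite hpos.
  by have [] := flux _ _ _ (boxn i j ord0).
have sumc (v : R) : \sum_(i < N) v = N%:R * v.
  by rewrite sumr_const card_ord mulr_natl.
have low : N%:R * (N%:R * (N%:R * c)) <=
    \sum_(i < N) \sum_(j < N) \sum_(k < N)
      (G1 (x i) (y j) (z k) + G2 (x i) (y j) (z k) + G3 (x i) (y j) (z k)).
  rewrite -sumc; apply: ler_sum => i _; rewrite -sumc; apply: ler_sum => j _.
  by rewrite -sumc; apply: ler_sum => k _; exact: div.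
move: s1 s2 s3; rewrite !sumc => s1 s2 s3.
have : N%:R * (N%:R * (N%:R * c)) <= N%:R * (N%:R * (N%:R * 
    ((D1 / l1 + e / 3) + (D2 / l2 + e / 3) + (D3 / l3 + e / 3)))).
  rewrite [leRHS](_ : _ = N%:R * (N%:R * (N%:R * (D1 / l1 + e / 3)))
    + N%:R * (N%:R * (N%:R * (D2 / l2 + e / 3)))
    + N%:R * (N%:R * (N%:R * (D3 / l3 + e / 3)))); last by rewrite !mulrDr.
  apply: le_trans low _.
  under eq_bigr do under eq_bigr do rewrite !big_split/=.
  under eq_bigr do rewrite !big_split/=.
  rewrite !big_split /=; apply: lerD; first apply: lerD => //.
  - apply: le_trans s1; rewrite le_eqVlt; apply/orP; left; apply/eqP.
    rewrite exchange_big /=; apply: eq_bigr => j _; exact: exchange_big.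
  - apply: le_trans s2; rewrite le_eqVlt; apply/orP; left; apply/eqP.
    by apply: eq_bigr => i _; exact: exchange_big.
  - exact: s3.
rewrite !ler_pM2l// => /le_trans; apply; lra.
Qed.

End BoxDivergence.

(** * Uniform difference quotients *)

Lemma near_eq_continuous (R : realType) (T : topologicalType) (f g : T -> R)
    (x : T) :
  (\forall y \near x, g y = f y) -> {for x, continuous g} ->
  {for x, continuous f}.
Proof.
move=> fg cg; have -> : {for x, continuous f} = (f @ x --> g x).
  by rewrite /prop_for /continuous_at; congr (_ --> _); rewrite (nbhs_singleton fg).
exact: cvg_trans (near_eq_cvg fg) cg.
Qed.

Section UniformDerivative.
Variables (R : realType) (V : normedModType R).
Implicit Types (f : V -> R) (x v : V).

(** Derivatives along [v] are ordinary derivatives of the restriction to a line;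
    this gives access to the mean value theorem and to the chain rule. *)
Lemma is_derive_line f x v (t d : R) :
  is_derive (t *: v + x) v f d <-> is_derive t 1 (fun s : R => f (s *: v + x)) d.
Proof.
have E : (fun h => h^-1 *: (((fun s => f (s *: v + x)) \o shift t) (h *: (1 : R))
    - f (t *: v + x))) =
    (fun h => h^-1 *: ((f \o shift (t *: v + x)) (h *: v) - f (t *: v + x))).
  by apply/funext => h /=; rewrite scalerDl addrA [h *: 1]mulr1.
by split=> -[df <-]; split; move: df; rewrite /derivable /derive E.
Qed.

Lemma is_derive_line0 f x v (d : R) :
  is_derive x v f d <-> is_derive (0 : R) 1 (fun s : R => f (s *: v + x)) d.
Proof. by rewrite -(@is_derive_line f x v 0 d) scale0r add0r. Qed.

Lemma is_derive_comp1 (f : R -> R) (g : V -> R) x v (d d' : R) :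
  is_derive (g x) 1 f d -> is_derive x v g d' ->
  is_derive x v (f \o g) (d * d').
Proof.
move=> df /is_derive_line0 dg; apply/is_derive_line0.
apply: (@is_derive1_comp _ f (fun s : R => g (s *: v + x))) => //.
by rewrite scale0r add0r.
Qed.

Lemma mean_value_line f x v (t : R) :
  (forall s : R, `|s| <= `|t| -> derivable f (s *: v + x) v) ->
  exists2 s : R, `|s| <= `|t| & f (t *: v + x) - f x = t * 'D_v f (s *: v + x).
Proof.
move=> df.
have dline (s : R) : `|s| <= `|t| ->
    is_derive s 1 (fun s => f (s *: v + x)) ('D_v f (s *: v + x)).
  by move=> st; apply/is_derive_line; apply: DeriveDef => //; exact: df.
have cont (a b : R) : (forall s : R, s \in `[a, b] -> `|s| <= `|t|) ->
    {within `[a, b], continuous (fun s => f (s *: v + x))}.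
  move=> ab; apply/derivable_within_continuous => s sab.
  by have [] := dline s (ab _ sab).
have [t0|t0] := leP 0 t.
  have sub (s : R) : s \in `[0, t] -> `|s| <= `|t|.
    by rewrite in_itv/= => /andP[s0 st]; rewrite !ger0_norm.
  have [s s0t E] := MVT_segment t0 (fun s st => dline s (sub s
    (subset_itv_oo_cc st))) (cont _ _ sub).
  exists s; first exact: sub.
  by rewrite scale0r add0r subr0 in E; rewrite E mulrC.
have sub (s : R) : s \in `[t, 0] -> `|s| <= `|t|.
  by rewrite in_itv/= => /andP[s0 st]; rewrite !ler0_norm ?lerN2// ltW.
have [s s0t E] := MVT_segment (ltW t0) (fun s st => dline s (sub s
  (subset_itv_oo_cc st))) (cont _ _ sub).
exists s; first exact: sub.
rewrite scale0r add0r sub0r in E.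
by rewrite -opprB E mulrN opprK mulrC.
Qed.

(** By the mean value theorem the error is the variation of the derivative on a
    segment close to [x], which continuity makes small, uniformly in [y]. *)
Lemma locally_uniform_derivative f x v (e : R) : 0 < e ->
  (\forall y \near x, derivable f y v) -> {for x, continuous ('D_v f)} ->
  \forall y \near x & h \near (0 : R),
    `|f (y + h *: v) - f y - h * 'D_v f y| <= e * `|h|.
Proof.
move=> e0 df cf; have e20 : 0 < e / 2 by rewrite divr_gt0.
have near_e : \forall y \near x, `|'D_v f x - 'D_v f y| < e / 2.
  by have /cvgrPdist_lt/(_ _ e20) := cf.
have /nbhs_ballP[r /= r0 rP] : \forall y \near x,
    derivable f y v /\ `|'D_v f x - 'D_v f y| < e / 2.
  exact: filterI.
have r20 : 0 < r / 2 by rewrite divr_gt0.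
have v0 : 0 < 1 + `|v| by rewrite ltr_pwDl.
exists (ball x (r / 2), ball (0 : R) (r / 2 / (1 + `|v|))).
  by split; apply: nbhsx_ballx; rewrite // divr_gt0.
move=> [y h] /= []; rewrite -!ball_normE /= sub0r normrN => xy hr.
have inball (s : R) : `|s| <= `|h| -> derivable f (s *: v + y) v /\
    `|'D_v f x - 'D_v f (s *: v + y)| < e / 2.
  move=> sh; apply: rP; rewrite -ball_normE /= [_ + y]addrC opprD addrA.
  rewrite (le_lt_trans (ler_normB _ _))// [ltRHS](splitr r) ltrD// normrZ.
  have : `|h| * (1 + `|v|) < r / 2 by rewrite -ltr_pdivlMr.
  have : `|s| * `|v| <= `|h| * `|v| by rewrite ler_wpM2r.
  have : 0 <= `|h| by [].
  lra.
have [s sh] := mean_value_line (fun s sh => (inball s sh).1).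
rewrite [_ + y]addrC => ->; rewrite -mulrBr normrM mulrC ler_wpM2r//.
have [_ ds] := inball s sh.
have [_] : derivable f y v /\ `|'D_v f x - 'D_v f y| < e / 2.
  by have := inball 0; rewrite scale0r add0r normr0; apply.
move: ds; rewrite !ltr_norml ler_norml; lra.
Qed.

(** This provides the uniform difference quotients that [box_divergence] asks
    for. *)
Lemma uniform_derivative (K : set V) f v (e : R) : 0 < e -> compact K ->
  (forall x, K x -> \forall y \near x, derivable f y v) ->
  (forall x, K x -> {for x, continuous ('D_v f)}) ->
  \forall h \near (0 : R), forall y, K y ->
    `|f (y + h *: v) - f y - h * 'D_v f y| <= e * `|h|.
Proof.
move=> e0 /compact_near_coveringP cK df cf.
apply: (cK _ (nbhs (0 : R)) (fun h y =>
  `|f (y + h *: v) - f y - h * 'D_v f y| <= e * `|h|)) => x Kx.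
exact: locally_uniform_derivative e0 (df _ Kx) (cf _ Kx).
Qed.

End UniformDerivative.

(** * The generators of the group and their Jacobians *)

Section Transformations.
Local Open Scope complex_scope.
Variable R : realType.

Lemma mulmxr_continuous m n (A : 'M[R]_(m, n)) :
  continuous (mulmxr A : 'rV[R]_m -> 'rV[R]_n).
Proof.
have -> : (mulmxr A : 'rV[R]_m -> 'rV[R]_n) =
    \sum_i (fun u : 'rV[R]_m => u 0 i *: row i A).
  by apply/funext => u; rewrite fct_sumE /=; exact: mulmx_sum_row.
elim/big_ind: _ => [|f g cf cg|i _] u.
- exact: cst_continuous.
- exact: continuousD (cf u) (cg u).
- by apply: continuousZr_tmp; exact: coord_continuous.
Qed.

Lemma jacobian_affine m n (A : 'M[R]_(m, n)) (c : 'rV[R]_n) (x : 'rV[R]_m) :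
  jacobian (fun y => y *m A + c) x = A.
Proof.
have lin : differentiable (mulmxr A : 'rV[R]_m -> 'rV[R]_n) x.
  exact: linear_differentiable (@mulmxr_continuous _ _ A).
have aff : differentiable (fun y : 'rV[R]_m => y *m A + c) x.
  exact: (@differentiableD _ _ _ (mulmxr A) (cst c)).
apply/row_matrixP => i; rewrite rowE -deriveEjacobian// [LHS]/derive.
rewrite rowE; apply: lim_near_cst => //.
near=> h => /=; rewrite mulmxDl.
have -> : h *: delta_mx 0 i *m A + x *m A + c - (x *m A + c) =
    h *: (delta_mx 0 i *m A).
  by rewrite opprD addrACA subrr addr0 addrK scalemxAl.
rewrite scalerA mulVf ?scale1r//.
by near: h; exact: nbhs_dnbhs_neq.
Unshelve. all: by end_near. Qed.

Lemma row4P (u v : 'rV[R]_4) : u 0 0 = v 0 0 -> u 0 1 = v 0 1 ->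
  u 0 2 = v 0 2 -> u 0 3 = v 0 3 -> u = v.
Proof.
move=> u0 u1 u2 u3; apply/rowP => -[[|[|[|[|//]]]] ?];
  [move: u0|move: u1|move: u2|move: u3]; congr (u _ _ = v _ _); exact: val_inj.
Qed.

Lemma sum4E (V : nmodType) (F : 'I_4 -> V) :
  \sum_i F i = F 0 + F 1 + F 2 + F 3.
Proof.
rewrite !big_ord_recl big_ord0 addr0 !addrA.
by congr (_ + F _ + F _ + F _); exact: val_inj.
Qed.

Variable D : inoue_data R.

Definition pt (w1 w2 z1 z2 : R) : 'rV[R]_4 := mkpoint (w1 +i* w2) (z1 +i* z2).

Lemma pt0E w1 w2 z1 z2 : pt w1 w2 z1 z2 0 0 = w1. Proof. by rewrite mxE. Qed.
Lemma pt1E w1 w2 z1 z2 : pt w1 w2 z1 z2 0 1 = w2. Proof. by rewrite mxE. Qed.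
Lemma pt2E w1 w2 z1 z2 : pt w1 w2 z1 z2 0 2 = z1. Proof. by rewrite mxE. Qed.
Lemma pt3E w1 w2 z1 z2 : pt w1 w2 z1 z2 0 3 = z2. Proof. by rewrite mxE. Qed.

Lemma pt_eta (x : 'rV[R]_4) : pt (x 0 0) (x 0 1) (x 0 2) (x 0 3) = x.
Proof. exact: mkpointK. Qed.

Lemma HC_pt w1 w2 z1 z2 : HC (pt w1 w2 z1 z2) <-> 0 < w2.
Proof. by rewrite /HC /= mxE. Qed.

Lemma coord1_gt0 (x : 'rV[R]_4) : HC x -> 0 < x 0 1.
Proof. by []. Qed.

Lemma HC_open : open (@HC R).
Proof.
have := @open_comp _ _ (fun x : 'rV[R]_4 => x 0 1) [set r | 0 < r].
apply; last exact: open_gt.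
by move=> x _; exact: coord_continuous.
Qed.

Lemma phiE i w1 w2 z1 z2 : phi D i (pt w1 w2 z1 z2) =
  pt (w1 + ia D 0 i) w2 (z1 + ib D 0 i * w1 + ic D 0 i) (z2 + ib D 0 i * w2).
Proof.
rewrite /phi /pt wcoordK zcoordK; congr mkpoint.
  by congr (_ +i* _); rewrite addr0.
by congr (_ +i* _); rewrite /= ?mul0r ?subr0 ?addr0.
Qed.

Lemma phi3E w1 w2 z1 z2 : phi3 D (pt w1 w2 z1 z2) =
  pt w1 w2 (z1 + inoue_step (ir D) (ia D) (ib D)) z2.
Proof.
rewrite /phi3 /pt wcoordK zcoordK; congr mkpoint.
by congr (_ +i* _); rewrite addr0.
Qed.

Lemma phi0E w1 w2 z1 z2 : phi0 D (pt w1 w2 z1 z2) =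
  pt (ialpha D * w1) (ialpha D * w2) (- z1) (- z2).
Proof.
rewrite /phi0 /pt wcoordK zcoordK; congr mkpoint.
by congr (_ +i* _); rewrite /= !mul0r ?subr0 ?addr0.
Qed.

(** The differential of [phi i] sends d/dw1 to d/dw1 + b d/dz1 and d/dw2 to
    d/dw2 + b d/dz2; row vectors multiply on the left. *)
Definition shear (b : R) : 'M[R]_4 :=
  \matrix_(i, j) ((i == j)%:R + b * (j == i.+2 :> nat)%:R).

Lemma jacobian_phi i x : jacobian (phi D i) x = shear (ib D 0 i).
Proof.
have -> : phi D i =
    fun y => y *m shear (ib D 0 i) + pt (ia D 0 i) 0 (ic D 0 i) 0.
  apply/funext => y; rewrite -(pt_eta y) phiE.
  apply/rowP => -[[|[|[|[|//]]]] ?]; rewrite !mxE !big_ord_recl big_ord0 !mxE /=;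
   ring.
exact: jacobian_affine.
Qed.

Lemma jacobian_phi3 x : jacobian (phi3 D) x = 1%:M.
Proof.
have -> : phi3 D =
    fun y => y *m 1%:M + pt 0 0 (inoue_step (ir D) (ia D) (ib D)) 0.
  apply/funext => y; rewrite mulmx1 -(pt_eta y) phi3E.
  by apply/rowP => -[[|[|[|[|//]]]] ?]; rewrite !mxE /= ?addr0.
exact: jacobian_affine.
Qed.

Lemma jacobian_phi0 x :
  jacobian (phi0 D) x = diag_mx (pt (ialpha D) (ialpha D) (- 1) (- 1)).
Proof.
have -> : phi0 D =
    fun y => y *m diag_mx (pt (ialpha D) (ialpha D) (- 1) (- 1)) + 0.
  apply/funext => y; rewrite addr0 -(pt_eta y) phi0E mul_mx_diag.
  by apply/rowP => -[[|[|[|[|//]]]] ?]; rewrite !mxE /= ?mulrN1 // mulrC.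
exact: jacobian_affine.
Qed.

End Transformations.
(** * Invariant functions are bounded on horizontal slabs *)

Section ClosedBox.
Variables (R : realType) (n : nat).

Definition closed_box (lo hi : 'rV[R]_n) : set 'rV[R]_n :=
  [set x | forall i, lo 0 i <= x 0 i <= hi 0 i].

Lemma closed_box_compact lo hi : compact (closed_box lo hi).
Proof.
have := @rV_compact R n (fun i => `[lo 0 i, hi 0 i]%classic)
  (fun i => @segment_compact _ _ _).
congr compact; apply/seteqP; split=> x /= h i; have := h i;
  by rewrite ?in_itv //= in_itv.
Qed.

Lemma compact_continuous_bounded (K : set 'rV[R]_n) (f : 'rV[R]_n -> R) :
  compact K -> (forall x, K x -> {for x, continuous f}) ->
  exists C, forall x, K x -> `|f x| <= C.
Proof.
move=> cK cf; have [M [_ fM]] : bounded_set (f @` K).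
  apply: compact_bounded; apply: continuous_compact => //.
  by apply: continuous_in_subspaceT => x; rewrite inE; exact: cf.
exists (M + 1) => x Kx.
by apply: (fM (M + 1)); [rewrite ltrDl | exists x].
Qed.

End ClosedBox.

Section Reduction.
Variables (R : realType) (D : inoue_data R).
Local Notation a := (ia D).
Local Notation b := (ib D).
Local Notation c3 := (inoue_step (ir D) (ia D) (ib D)).

(** The vectors (a_i, b_i) form a basis of the plane, hence generate a lattice:
    this is what makes the group generated by [phi 0], [phi 1], [phi3] act
    cocompactly on the level sets of w2. *)
Lemma eigenvectors_det : b 0 0 * a 0 1 - b 0 1 * a 0 0 != 0.
Proof.
apply/eqP => det0.
have al0 : 0 < ialpha D by rewrite (lt_trans ltr01)// ialpha_gt1.
have ea := ia_eigen D; have eb := ib_eigen D.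
(* proportional eigenvectors would have the same eigenvalue, but [alpha] and
     [- alpha^-1] have opposite signs *)
have prop (k : R) : b = k *: a -> False.
  move=> bka; have := eb; rewrite bka -scalemxAl ea !scalerA => /eqP.
  rewrite -subr_eq0 -scalerBl scaler_eq0 (negbTE (ia_neq0 D)) orbF => /eqP h.
  have /eqP : k * (ialpha D + (ialpha D)^-1) = 0 by rewrite -h; ring.
  rewrite mulf_eq0 [X in _ || X]gt_eqF ?addr_gt0 ?invr_gt0// orbF => /eqP k0.
  by have := ib_neq0 D; rewrite bka k0 scale0r eqxx.
have row2 (u v : 'rV[R]_2) : u 0 0 = v 0 0 -> u 0 1 = v 0 1 -> u = v.
  move=> h0 h1; apply/rowP => -[[|[|//]] ?].
    by rewrite (_ : Ordinal _ = 0)//; exact: val_inj.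
  by rewrite (_ : Ordinal _ = 1)//; exact: val_inj.
have [a00|a00] := eqVneq (a 0 0) 0.
  have [a01|a01] := eqVneq (a 0 1) 0.
    by have /eqP := ia_neq0 D; apply; apply: row2; rewrite !mxE.
  apply: (prop (b 0 1 / a 0 1)); apply: row2; rewrite !mxE ?divfK//.
  move: det0; rewrite a00 !mulr0 subr0 => /eqP.
  by rewrite mulf_eq0 (negbTE a01) orbF => /eqP.
apply: (prop (b 0 0 / a 0 0)); apply: row2; rewrite !mxE ?divfK//.
apply: (mulIf a00); rewrite mulrAC divfK//; apply/esym/eqP.
by rewrite -subr_eq0 det0.
Qed.

Lemma step_neq0 : c3 != 0.
Proof.
by rewrite /inoue_step mulf_neq0 ?eigenvectors_det// invr_eq0 intr_eq0 ir_neq0.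
Qed.

Lemma floor_shift (x y : R) : y != 0 ->
  exists n : int, `|x + n%:~R * y| <= `|y|.
Proof.
move=> y0; exists (- Num.floor (x / y)); rewrite mulrNz mulNr.
have -> : x - (Num.floor (x / y))%:~R * y = (x / y - (Num.floor (x / y))%:~R) * y.
  by rewrite mulrBl divfK.
rewrite normrM ler_piMl// ler_norml.
have := floor_le_tmp (x / y); have := lt_succ_floor (x / y).
rewrite intrD1; lra.
Qed.
Section InvariantFunction.
Variable f : 'rV[R]_4 -> R.
Hypothesis f_phi : forall i x, HC x -> f (phi D i x) = f x.
Hypothesis f_phi3 : forall x, HC x -> f (phi3 D x) = f x.

(** What happens to z1 is left unspecified, since it is corrected afterwards by a
    power of [phi3]. *)
Lemma shift_phi i (n : int) w1 w2 z1 z2 : 0 < w2 ->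
  exists z1', f (pt w1 w2 z1 z2) =
    f (pt (w1 + n%:~R * a 0 i) w2 z1' (z2 + n%:~R * b 0 i * w2)).
Proof.
move=> w20.
have up v1 y1 y2 : exists y1', f (pt v1 w2 y1 y2) =
    f (pt (v1 + a 0 i) w2 y1' (y2 + b 0 i * w2)).
  by rewrite -(f_phi i) ?HC_pt// phiE; eexists.
have down v1 y1 y2 : exists y1', f (pt v1 w2 y1 y2) =
    f (pt (v1 - a 0 i) w2 y1' (y2 - b 0 i * w2)).
  exists (y1 - b 0 i * (v1 - a 0 i) - ic D 0 i).
  by rewrite -[RHS](f_phi i) ?HC_pt// phiE !subrK addrAC !subrK.
elim: n => [|n [y ->]|n [y ->]].
- by exists z1; rewrite !mul0r !addr0.
- have [y' ->] := up (w1 + n%:Z%:~R * a 0 i) y (z2 + n%:Z%:~R * b 0 i * w2).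
  by exists y'; congr (f (pt _ _ _ _)); rewrite -!pmulrn -!natr1; ring.
- have [y' ->] := down (w1 + (- n%:Z)%:~R * a 0 i) y
    (z2 + (- n%:Z)%:~R * b 0 i * w2).
  exists y'; congr (f (pt _ _ _ _)); rewrite !mulrNz -!pmulrn -!natr1; ring.
Qed.

Lemma shift_phi3 (n : int) w1 w2 z1 z2 : 0 < w2 ->
  f (pt w1 w2 z1 z2) = f (pt w1 w2 (z1 + n%:~R * c3) z2).
Proof.
move=> w20; elim: n => [|n ->|n ->]; first by rewrite mul0r addr0.
- rewrite -[LHS]f_phi3 ?HC_pt// phi3E; congr (f (pt _ _ _ _)).
  by rewrite -!pmulrn -!natr1; ring.
- rewrite -[RHS]f_phi3 ?HC_pt// phi3E; congr (f (pt _ _ _ _)).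
  by rewrite !mulrNz -!pmulrn -!natr1; ring.
Qed.

(** Over a compact range of w2, every orbit of the group generated by [phi 0],
    [phi 1] and [phi3] meets a fixed compact box: powers of the [phi i] bring
    (w1, z2 / w2) into a fundamental parallelogram of the lattice of the
    (a_i, b_i), then a power of [phi3] brings z1 into an interval. *)
Lemma invariant_bounded (T : R) :
  (forall x, HC x -> {for x, continuous f}) ->
  exists C, forall w1 w2 z1 z2, 1 <= w2 <= T -> `|f (pt w1 w2 z1 z2)| <= C.
Proof.
move=> cf.
pose A := `|a 0 0| + `|a 0 1|; pose B := (`|b 0 0| + `|b 0 1|) * T.
pose K := closed_box (pt (- A) 1 (- `|c3|) (- B)) (pt A T `|c3| B).
have [x Kx|C fC] :=
  compact_continuous_bounded (K := K) (f := f) (@closed_box_compact _ _ _ _).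
  by apply: cf; have := Kx 1; rewrite !pt1E => /andP[/(lt_le_trans ltr01)].
exists C => w1 w2 z1 z2 w2T.
have w20 : 0 < w2 by rewrite (lt_le_trans ltr01)//; case/andP: w2T.
suff [v1 [v2 [y1 [y2 [-> Kv]]]]] : exists v1 v2 y1 y2,
    f (pt w1 w2 z1 z2) = f (pt v1 v2 y1 y2) /\ K (pt v1 v2 y1 y2).
  exact: fC.
have det0 := eigenvectors_det.
set d := b 0 0 * a 0 1 - b 0 1 * a 0 0 in det0.
(* the coordinates of (w1, z2 / w2) in the basis (a1, b1), (a2, b2) *)
pose t0 := (z2 / w2 * a 0 1 - w1 * b 0 1) / d.
pose t1 := (w1 * b 0 0 - z2 / w2 * a 0 0) / d.
have w1E : w1 = t0 * a 0 0 + t1 * a 0 1.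
  by rewrite /t0 /t1 /d; field; rewrite -/d det0 gt_eqF.
have z2E : z2 = (t0 * b 0 0 + t1 * b 0 1) * w2.
  by rewrite /t0 /t1 /d; field; rewrite -/d det0 gt_eqF.
have [n0 /=] := floor_shift t0 (oner_neq0 R); rewrite mulr1 normr1 => n0P.
have [n1 /=] := floor_shift t1 (oner_neq0 R); rewrite mulr1 normr1 => n1P.
have [y1 ->] := shift_phi 0 n0 w1 z1 z2 w20.
have [y2 ->] := shift_phi 1 n1 (w1 + n0%:~R * a 0 0) y1
  (z2 + n0%:~R * b 0 0 * w2) w20.
have [n3 n3P] := floor_shift y2 step_neq0.
rewrite (shift_phi3 n3)//; do 4!eexists; split; first by [].
have -> : w1 + n0%:~R * a 0 0 + n1%:~R * a 0 1 =
    (t0 + n0%:~R) * a 0 0 + (t1 + n1%:~R) * a 0 1 by rewrite w1E; ring.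
have -> : z2 + n0%:~R * b 0 0 * w2 + n1%:~R * b 0 1 * w2 =
    ((t0 + n0%:~R) * b 0 0 + (t1 + n1%:~R) * b 0 1) * w2 by rewrite z2E; ring.
have comb (u v : R) : `|(t0 + n0%:~R) * u + (t1 + n1%:~R) * v| <= `|u| + `|v|.
  by rewrite (le_trans (ler_normD _ _))// lerD// normrM ler_piMl.
move=> [[|[|[|[|//]]]] ?]; rewrite !mxE /=.
- by rewrite -ler_norml comb.
- by [].
- by rewrite -ler_norml.
- rewrite -ler_norml normrM ler_pM// (gtr0_norm w20).
  by case/andP: w2T.
Qed.

End InvariantFunction.
End Reduction.

(** * The coordinate log z2 *)

Section Logarithmic.
Variable R : realType.
Implicit Types (F : 'rV[R]_4 -> R) (y : 'rV[R]_4) (i : 'I_4).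

(** Reads a point whose last coordinate is v = log z2. Only the half z2 > 0 of
    the surface w1 = 0 is explored, which is enough: it is unbounded. *)
Definition exp_z2 y : 'rV[R]_4 := pt (y 0 0) (y 0 1) (y 0 2) (expR (y 0 3)).

Lemma exp_z2E y : exp_z2 y = (expR (y 0 3) - y 0 3) *: delta_mx 0 3 + y.
Proof.
by by apply: row4P; rewrite !mxE /= ?mulr0 ?add0r ?mulr1 ?subrK.
Qed.

Lemma exp_z2_continuous : continuous exp_z2.
Proof.
have -> : exp_z2 = fun y => (expR (y 0 3) - y 0 3) *: delta_mx 0 3 + y.
  by apply/funext => y; exact: exp_z2E.
move=> y; apply: (@continuousD _ _ _
  (fun y : 'rV[R]_4 => (expR (y 0 3) - y 0 3) *: delta_mx 0 3) id);
  last exact: cvg_id.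
apply: continuousZr_tmp.
apply: (@continuousB _ _ _ (fun y : 'rV[R]_4 => expR (y 0 3)));
  last exact: coord_continuous.
apply: (@continuous_comp _ _ _ (fun y : 'rV[R]_4 => y 0 3) expR).
  exact: coord_continuous.
exact: continuous_expR.
Qed.

Lemma HC_exp_z2 y : HC (exp_z2 y) = HC y.
Proof. by rewrite /HC /= !mxE. Qed.

Lemma is_derive_exp_z2 F y i d : i != 3 ->
  is_derive (exp_z2 y) (delta_mx 0 i) F d ->
  is_derive y (delta_mx 0 i) (F \o exp_z2) d.
Proof.
move=> i3 /is_derive_line0 dF; apply/is_derive_line0.
suff -> : (fun s : R => (F \o exp_z2) (s *: delta_mx 0 i + y)) =
    (fun s : R => F (s *: delta_mx 0 i + exp_z2 y)) by [].
apply/funext => s /=; rewrite !exp_z2E !mxE eqxx eq_sym (negbTE i3) /=.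
by rewrite mulr0 add0r addrCA.
Qed.

Lemma is_derive_exp_z2_last F y d :
  is_derive (exp_z2 y) (delta_mx 0 3) F d ->
  is_derive y (delta_mx 0 3) (F \o exp_z2) (d * expR (y 0 3)).
Proof.
move=> /is_derive_line0 dF; apply/is_derive_line0.
pose k s := expR (s + y 0 3) - expR (y 0 3).
have -> : (fun s : R => (F \o exp_z2) (s *: delta_mx 0 3 + y)) =
    (fun r : R => F (r *: delta_mx 0 3 + exp_z2 y)) \o k.
  apply/funext => s /=; rewrite !exp_z2E !mxE eqxx /= mulr1.
  by rewrite !addrA -!scalerDl; congr (F (_ *: _ + _)); rewrite /k; ring.
have k0 : k 0 = 0 by rewrite /k add0r subrr.
apply: is_derive1_comp; first by rewrite k0.
have -> : expR (y 0 3) = expR (shift (y 0 3) 0) * 1 - 0.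
  by rewrite /= add0r mulr1 subr0.
apply: (@is_deriveB _ _ _ (expR \o shift (y 0 3)) (cst (expR (y 0 3)))).
exact: is_derive1_comp (is_derive_expR _) (is_derive_shift _ _ _).
Qed.

Lemma is_derive_expN y :
  is_derive y (delta_mx 0 3) (fun y => expR (- y 0 3)) (- expR (- y 0 3)).
Proof.
apply/is_derive_line0.
have -> : (fun s : R => expR (- (s *: delta_mx 0 3 + y) 0 3)) =
    expR \o (fun s => - (s + y 0 3)).
  by apply/funext => s; rewrite !mxE eqxx /= mulr1.
have -> : - expR (- y 0 3) = expR (- shift (y 0 3) 0) * - 1.
  by rewrite /= add0r mulrN1.
apply: (@is_derive1_comp _ expR (- shift (y 0 3))).
exact: is_deriveN (is_derive_shift _ _ _).
Qed.

End Logarithmic.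

(** * Twisted closed forms with a definite component *)

Section TwistedClosed.
Variables (R : realType) (D : inoue_data R) (o : tensor2 R) (l : R).
Hypothesis o_C1 : forall i j, Ck_on 1 (@HC R) (fun x => o x i j).
Hypothesis o_inv : forall g, inoue_group D g ->
  forall x, HC x -> pullback2 g o x = o x.
Hypothesis o_skew : forall x, HC x -> o x 3 2 = - o x 2 3.
Hypothesis o_neg : forall x, HC x -> o x 2 3 < 0.
Hypothesis o_closed : forall x, HC x ->
  ext_d2 o x 1 2 3 = l / x 0 1 * o x 2 3.

Lemma phi_inv i x : HC x -> let o' := o (phi D i x) in
  [/\ o' 2 3 = o x 2 3, o' 3 2 = o x 3 2 & o x 1 2 = o' 1 2 + ib D 0 i * o' 3 2].
Proof.
move=> Hx o'; have := o_inv (inoue_group_phi D i) Hx.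
rewrite /pullback2 jacobian_phi -/o' => <-.
rewrite !mxE !sum4E !mxE !sum4E !mxE /=.
by split; ring.
Qed.

Lemma phi3_inv x : HC x -> o (phi3 D x) = o x.
Proof.
move=> Hx; have := o_inv (inoue_group_phi3 D) Hx.
by rewrite /pullback2 jacobian_phi3 trmx1 mulmx1 mul1mx.
Qed.

(** The differential of [phi0] is -1 on z, so it preserves the coefficient of
    dz1 /\ dz2. *)
Lemma phi0_inv x : HC x -> o (phi0 D x) 2 3 = o x 2 3.
Proof.
move=> Hx; have <- := o_inv (inoue_group_phi0 D) Hx.
rewrite /pullback2 jacobian_phi0 tr_diag_mx mul_mx_diag mul_diag_mx !mxE /=.
by ring.
Qed.

(** The square of [phi0] is (w, z) -> (alpha^2 w, z): it rescales w2 on the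
    slice w1 = 0 without moving z. *)
Lemma o23_periodic w2 z1 z2 : 0 < w2 ->
  o (pt 0 (ialpha D ^+ 2 * w2) z1 z2) 2 3 = o (pt 0 w2 z1 z2) 2 3.
Proof.
have al0 : 0 < ialpha D by rewrite (lt_trans ltr01)// ialpha_gt1.
move=> w20; have /phi0_inv <- : HC (pt 0 w2 z1 z2) by apply/HC_pt.
rewrite phi0E mulr0; set x := pt 0 (ialpha D * w2) (- z1) (- z2).
have /phi0_inv <- : HC x.
  by apply/HC_pt; rewrite mulr_gt0.
by rewrite phi0E mulr0 !opprK mulrA -expr2.
Qed.

Lemma o31_periodic w1 w2 z1 z2 : 0 < w2 ->
  let c3 := inoue_step (ir D) (ia D) (ib D) in
  o (pt w1 w2 (z1 + `|c3|) z2) 3 1 = o (pt w1 w2 z1 z2) 3 1.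
Proof.
move=> w20 c3; rewrite normrEsg sgrEz; apply/esym.
apply: (@shift_phi3 _ D (fun x => o x 3 1)) => // x Hx.
by rewrite phi3_inv.
Qed.

Lemma continuous_o i j x : HC x -> {for x, continuous (fun x => o x i j)}.
Proof. by have [+ _] := o_C1 i j; exact. Qed.

Lemma continuous_partial_o k i j x : HC x ->
  {for x, continuous (partial k (fun x => o x i j))}.
Proof. by have [_ /(_ k)[_ [+ _]]] := o_C1 i j; exact. Qed.

Lemma is_derive_o k i j x : HC x ->
  is_derive x (delta_mx 0 k) (fun x => o x i j) (partial k (fun x => o x i j) x).
Proof.
by have [_ /(_ k)[+ _]] := o_C1 i j => /[apply] ?; exact: DeriveDef.
Qed.

(** The value of the form on (d/dw2 + (z2 / w2) d/dz2, d/dz1). Unlike d/dw2, this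
    first field is invariant under the [phi i], so this value is bounded, and the
    coefficient of dw2 /\ dz1 grows at most linearly in z2. *)
Definition frame12 (x : 'rV[R]_4) : R := o x 1 2 - x 0 3 / x 0 1 * o x 2 3.

Lemma frame12_bounded (T : R) : exists C, forall w1 w2 z1 z2, 1 <= w2 <= T ->
  `|frame12 (pt w1 w2 z1 z2)| <= C.
Proof.
apply: (@invariant_bounded _ D) => [i x Hx|x Hx|x Hx].
- have [e23 _ e12] := phi_inv i Hx.
  have Hx' : HC (phi D i x).
    by rewrite -(pt_eta x) phiE; apply/HC_pt; exact: coord1_gt0.
  rewrite /frame12 e12 o_skew// e23; set u := o (phi D i x) 1 2.
  rewrite -(pt_eta x) phiE !pt1E !pt3E; field.
  by rewrite gt_eqF// coord1_gt0.
- rewrite /frame12 phi3_inv//; congr (_ - _ * _).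
  by rewrite -(pt_eta x) phi3E !pt1E !pt3E.
- apply: (@continuousB _ _ _ (fun x => o x 1 2)); first exact: continuous_o.
  apply: (@continuousM _ _ (fun x : 'rV[R]_4 => x 0 3 / x 0 1));
    last exact: continuous_o.
  apply: (@continuousM _ _ (fun x : 'rV[R]_4 => x 0 3)).
    exact: coord_continuous.
  apply: continuousV; last exact: coord_continuous.
  by rewrite gt_eqF// coord1_gt0.
Qed.

Lemma o23_bounded (T : R) : exists m M, 0 < m /\
  forall w1 w2 z1 z2, 1 <= w2 <= T -> m <= - o (pt w1 w2 z1 z2) 2 3 <= M.
Proof.
have o0 x : HC x -> o x 2 3 != 0 by move=> Hx; rewrite lt_eqF// o_neg.
have [|x Hx|x Hx|M oM] := @invariant_bounded _ D (fun x => o x 2 3) _ _ T.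
- by move=> i x /(phi_inv i)[].
- by rewrite phi3_inv.
- exact: continuous_o.
have [|x Hx|x Hx|m om] := @invariant_bounded _ D (fun x => (o x 2 3)^-1) _ _ T.
- by move=> i x /(phi_inv i)[->].
- by rewrite phi3_inv.
- by apply: continuousV; [exact: o0 | exact: continuous_o].
exists (1 + `|m|)^-1, M; split; first by rewrite invr_gt0 ltr_pwDl.
move=> w1 w2 z1 z2 w2T; set x := pt w1 w2 z1 z2.
have Hx : HC x by apply/HC_pt; case/andP: w2T => /(lt_le_trans ltr01).
have := oM w1 w2 z1 z2 w2T; have := om w1 w2 z1 z2 w2T.
rewrite -/x ltr0_norm ?invr_lt0 ?o_neg// ltr0_norm ?o_neg// => h1 ->.
rewrite andbT invf_ple ?posrE ?ltr_pwDl ?oppr_gt0 ?o_neg// invrN.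
by rewrite (le_trans h1)// (le_trans (ler_norm _))// lerDr.
Qed.

(* The vector field on (w2, z1, v), where z2 = e^v, whose flux is studied, and the
   three terms of its divergence. The last component of the form is divided by
   z2 = e^v: this keeps it bounded. *)
Let f1 := (fun x => o x 2 3) \o @exp_z2 R.
Let f2 := (fun x => o x 3 1) \o @exp_z2 R.
Let f3 := (fun y : 'rV[R]_4 => expR (- y 0 3)) \* ((fun x => o x 1 2) \o @exp_z2 R).
Let g1 := partial 1 (fun x => o x 2 3) \o @exp_z2 R.
Let g2 := partial 2 (fun x => o x 3 1) \o @exp_z2 R.
Let g3 y := partial 3 (fun x => o x 1 2) (exp_z2 y)
  - expR (- y 0 3) * o (exp_z2 y) 1 2.

Lemma is_derive_f1 y : HC y -> is_derive y (delta_mx 0 1) f1 (g1 y).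
Proof.
by move=> Hy; apply: is_derive_exp_z2 => //; apply: is_derive_o; rewrite HC_exp_z2.
Qed.

Lemma is_derive_f2 y : HC y -> is_derive y (delta_mx 0 2) f2 (g2 y).
Proof.
by move=> Hy; apply: is_derive_exp_z2 => //; apply: is_derive_o; rewrite HC_exp_z2.
Qed.

Lemma is_derive_f3 y : HC y -> is_derive y (delta_mx 0 3) f3 (g3 y).
Proof.
move=> Hy; apply: is_derive_eq.
  apply: is_deriveM; first exact: is_derive_expN.
  by apply: is_derive_exp_z2_last; apply: is_derive_o; rewrite HC_exp_z2.
rewrite /g3 /GRing.scale /= mulrCA -expRD addNr expR0 mulr1.
by rewrite mulrN [X in _ - X]mulrC.
Qed.

Lemma continuous_g1 y : HC y -> {for y, continuous g1}.
Proof.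
move=> Hy; apply: continuous_comp; first exact: exp_z2_continuous.
by apply: continuous_partial_o; rewrite HC_exp_z2.
Qed.

Lemma continuous_g2 y : HC y -> {for y, continuous g2}.
Proof.
move=> Hy; apply: continuous_comp; first exact: exp_z2_continuous.
by apply: continuous_partial_o; rewrite HC_exp_z2.
Qed.

Lemma continuous_g3 y : HC y -> {for y, continuous g3}.
Proof.
move=> Hy; have Hy' : HC (exp_z2 y) by rewrite HC_exp_z2.
apply: (@continuousB _ _ _ (partial 3 (fun x => o x 1 2) \o @exp_z2 R)).
  apply: continuous_comp; first exact: exp_z2_continuous.
  exact: continuous_partial_o.
apply: (@continuousM _ _ (fun y : 'rV[R]_4 => expR (- y 0 3))).
  apply: (@continuous_comp _ _ _ (fun y : 'rV[R]_4 => - y 0 3) expR).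
    by apply: continuousN; exact: coord_continuous.
  exact: continuous_expR.
apply: (@continuous_comp _ _ _ (@exp_z2 R) (fun x => o x 1 2)).
  exact: exp_z2_continuous.
exact: continuous_o.
Qed.

Lemma uniform_derivative_HC (f g : 'rV[R]_4 -> R) k (K : set 'rV[R]_4) e :
  0 < e -> compact K -> K `<=` @HC R ->
  (forall y, HC y -> is_derive y (delta_mx 0 k) f (g y)) ->
  (forall y, HC y -> {for y, continuous g}) ->
  \forall h \near (0 : R), forall y, K y ->
    `|f (y + h *: delta_mx 0 k) - f y - h * g y| <= e * `|h|.
Proof.
move=> e0 cK KH df cg.
have nearH x : K x -> \forall y \near x, HC y.
  by move=> /KH Hx; apply: open_nbhs_nbhs; split => //; exact: HC_open.
have : \forall h \near (0 : R), forall y, K y ->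
    `|f (y + h *: delta_mx 0 k) - f y - h * 'D_(delta_mx 0 k) f y| <= e * `|h|.
  apply: uniform_derivative => // x Kx.
    by apply: filterS (nearH x Kx) => y /df[].
  apply: (@near_eq_continuous _ _ _ g); last exact: cg (KH _ Kx).
  by apply: filterS (nearH x Kx) => y /df[_ ->].
apply: filterS => h hK y Ky.
by have := hK _ Ky; rewrite (@derive_val _ _ _ _ _ _ _ (df _ (KH _ Ky))).
Qed.

(** The equation gives [l / w2] times the coefficient of dz1 /\ dz2; dividing by z2
    the component that grows linearly in z2 lowers [l] to [l - 1]. The error term
    decays like 1 / z2. *)
Lemma divergence_log y : HC y -> g1 y + g2 y + g3 y =
  (1 - l) / y 0 1 * - o (exp_z2 y) 2 3 - expR (- y 0 3) * frame12 (exp_z2 y).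
Proof.
move=> Hy; have Hy' : HC (exp_z2 y) by rewrite HC_exp_z2.
have := o_closed Hy'; rewrite /ext_d2 /exp_z2 pt1E -/(exp_z2 y) => E.
rewrite /g3 addrA E /frame12 /exp_z2 pt1E pt3E -/(exp_z2 y).
rewrite mulrBr [expR (- y 0 3) * (_ / _ * _)]mulrA mulrA -expRD addNr expR0; ring.
Qed.

Lemma exp_z2_pt w1 w2 z1 v :
  exp_z2 (pt w1 w2 z1 v) = pt w1 w2 z1 (expR v) :> 'rV[R]_4.
Proof. by rewrite /exp_z2 pt0E pt1E pt2E pt3E. Qed.

(** The linear growth in z2 found in [frame12] is absorbed by the factor
    1 / z2. *)
Lemma log_flux_bound (C M : R) (y : 'rV[R]_4) : 1 <= y 0 1 -> 0 <= y 0 3 ->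
  `|frame12 (exp_z2 y)| <= C -> `|o (exp_z2 y) 2 3| <= M -> `|f3 y| <= C + M.
Proof.
move=> y1 y3 sC oM; have y10 : 0 < y 0 1 by exact: lt_le_trans ltr01 y1.
have -> : f3 y = expR (- y 0 3) * frame12 (exp_z2 y) + o (exp_z2 y) 2 3 / y 0 1.
  rewrite /frame12 /exp_z2 pt1E pt3E -/(exp_z2 y) mulrBr /f3 /=.
  rewrite mulrA mulrA -expRD addNr expR0.
  rewrite mul1r mulrC [_ * o _ 2 3]mulrC subrK mulrC //.
rewrite (le_trans (ler_normD _ _))// lerD// normrM.
  rewrite ger0_norm ?expR_ge0// (le_trans _ sC)// ler_piMl//.
  by rewrite -[leRHS]expR0 ler_expR oppr_le0.
rewrite (le_trans _ oM)// ler_piMr// normfV gtr0_norm//.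
by rewrite invf_le1.
Qed.

(** If [l < 1], the vector field above has divergence at least [c > 0] far out,
    on boxes [[1, alpha^2] x [0, |c3|] x [v0, v0 + l3]]. It has no net flux in the
    first two directions, by periodicity under [phi0 \o phi0] and [phi3], and a
    flux bounded independently of [l3] in the third one. Letting [l3] grow
    contradicts [box_divergence]. *)
Lemma twisted_closed_ge1 : 1 <= l.
Proof.
rewrite leNgt; apply/negP => l1.
have al1 := ialpha_gt1 D; have al0 : 0 < ialpha D by rewrite (lt_trans ltr01).
pose T := ialpha D ^+ 2; have T1 : 1 < T by rewrite exprn_egt1.
have T0 : 0 < T by rewrite (lt_trans ltr01).
pose c3 := inoue_step (ir D) (ia D) (ib D).
have [C oC] := frame12_bounded T.
have [m [M [m0 oM]]] := o23_bounded T.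
have C0 : 0 <= C.
  by have := oC 0 1 0 0; rewrite lexx ltW// => /(_ isT); exact: le_trans.
have M0 : 0 <= M.
  have := oM 0 1 0 0; rewrite lexx ltW// => /(_ isT)/andP[h1 h2].
  by rewrite (le_trans _ h2)// (le_trans _ h1)// ltW.
pose c := (1 - l) * m / T / 2.
have c0 : 0 < c by rewrite !divr_gt0// mulr_gt0// subr_gt0.
(* beyond v0 the error term of the divergence is at most [c] *)
pose v0 := C / c; have v00 : 0 <= v0 by rewrite divr_ge0// ltW.
pose d := 2 * (C + M); have d0 : 0 <= d by rewrite mulr_ge0 ?addr_ge0.
pose l3 := d / c + 1; have l30 : 0 < l3 by rewrite ltr_wpDl// divr_ge0// ltW.
suff : c <= 0 / (T - 1) + 0 / `|c3| + d / l3.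
  rewrite !mul0r !add0r leNgt => /negP; apply.
  by rewrite ltr_pdivrMr// /l3 mulrDr mulr1 mulrCA mulfV ?mulr1 ?gt_eqF// ltrDl.
pose K := closed_box (pt 0 1 0 v0) (pt 0 T `|c3| (v0 + l3)).
have KH : K `<=` @HC R.
  by move=> x /(_ 1); rewrite !pt1E => /andP[/(lt_le_trans ltr01)].
have T1E : 1 + (T - 1) = T by rewrite addrC subrK.
have Kpt t x v : [&& 1 <= t <= 1 + (T - 1), 0 <= x <= 0 + `|c3|
    & v0 <= v <= v0 + l3] -> K (pt 0 t x v).
  rewrite T1E add0r => /and3P[ht hx hv] i.
  by case: i => -[|[|[|[|//]]]] ?; rewrite !mxE //= lexx.
apply: (@box_divergence _ (fun t x v => f1 (pt 0 t x v))
  (fun t x v => f2 (pt 0 t x v)) (fun t x v => f3 (pt 0 t x v))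
  (fun t x v => g1 (pt 0 t x v)) (fun t x v => g2 (pt 0 t x v))
  (fun t x v => g3 (pt 0 t x v)) 1 0 v0).
- by rewrite subr_gt0.
- by rewrite normr_gt0 step_neq0.
- by [].
- move=> e e0.
  have cK : compact K by exact: closed_box_compact.
  have h1 := uniform_derivative_HC e0 cK KH is_derive_f1 continuous_g1.
  have h2 := uniform_derivative_HC e0 cK KH is_derive_f2 continuous_g2.
  have h3 := uniform_derivative_HC e0 cK KH is_derive_f3 continuous_g3.
  near=> h => t x v /Kpt Kx.
  have s1 : pt 0 (t + h) x v = pt 0 t x v + h *: delta_mx 0 1.
    by apply: row4P; rewrite !mxE /= ?mulr0 ?mulr1 ?addr0.
  have s2 : pt 0 t (x + h) v = pt 0 t x v + h *: delta_mx 0 2.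
    by apply: row4P; rewrite !mxE /= ?mulr0 ?mulr1 ?addr0.
  have s3 : pt 0 t x (v + h) = pt 0 t x v + h *: delta_mx 0 3.
    by apply: row4P; rewrite !mxE /= ?mulr0 ?mulr1 ?addr0.
  by split; rewrite ?s1 ?s2 ?s3; move: (pt 0 t x v) Kx; near: h.
- move=> t x v /and3P[/andP[t1 tT] _ /andP[v1 v2]].
  have t0 : 0 < t by rewrite (lt_le_trans ltr01).
  split.
  + rewrite /f1 /= /exp_z2 !pt0E !pt1E !pt2E !pt3E T1E -[T]mulr1 o23_periodic//.
    by rewrite subrr normr0.
  + by rewrite /f2 /= /exp_z2 !pt0E !pt1E !pt2E !pt3E o31_periodic// subrr normr0.
  + have f3b v' : 0 <= v' -> `|f3 (pt 0 t x v')| <= C + M.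
      move=> v'0; have tT' : 1 <= t <= T by rewrite t1 -T1E.
      apply: log_flux_bound; rewrite ?pt1E ?pt3E// ?exp_z2_pt; first exact: oC.
      have Hx : HC (pt 0 t x (expR v')) by apply/HC_pt.
      have /andP[_] := oM 0 t x (expR v') tT'.
      by rewrite ltr0_norm// o_neg.
    rewrite (le_trans (ler_normB _ _))// /d mulr_natl mulr2n lerD// f3b//.
    by rewrite addr_ge0// ltW.
- move=> t x v /[dup] /Kpt Kx /and3P[/andP[t1 tT] _ /andP[v1 v2]].
  have t0 : 0 < t by rewrite (lt_le_trans ltr01).
  have tT' : 1 <= t <= T by rewrite t1 -T1E.
  rewrite divergence_log; last exact: KH.
  rewrite pt1E pt3E exp_z2_pt.
  have h1 : expR (- v) * frame12 (pt 0 t x (expR v)) <= c.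
    rewrite (le_trans (ler_norm _))// normrM gtr0_norm ?expR_gt0//.
    rewrite expRN ler_pdivrMl ?expR_gt0// (le_trans (oC _ _ _ _ tT'))//.
    have : 1 + v <= expR v by exact: expR_ge1Dx.
    have : C = v0 * c by rewrite /v0 divfK// gt_eqF.
    have : v0 * c <= v * c by rewrite ler_pM2r.
    have : (1 + v <= expR v) -> (1 + v) * c <= expR v * c by rewrite ler_pM2r.
    by move=> + + + /[dup] h => /(_ h); lra.
  have h2 : 2 * c <= (1 - l) / t * - o (pt 0 t x (expR v)) 2 3.
    rewrite /c mulrC divfK// mulrAC ler_pM//.
    - by rewrite divr_ge0 ?subr_ge0// ltW.
    - exact: ltW.
    - by rewrite ler_pM2l ?subr_gt0// lef_pV2// -T1E.
    - by have /andP[] := oM 0 t x (expR v) tT'.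
  lra.
Unshelve. all: by end_near. Qed.

End TwistedClosed.

(** * The Lee form of omega *)

Section OmegaLee.
Local Open Scope complex_scope.
Variable R : realType.
Implicit Types (x y : 'rV[R]_4) (k : 'I_4).

Lemma is_derive_coord x k i :
  is_derive x (delta_mx 0 k) (fun y : 'rV[R]_4 => y 0 i) (k == i)%:R.
Proof.
split; first exact/diff_derivable/differentiable_coord.
apply: lim_near_cst => //; near=> h => /=.
rewrite !mxE eqxx /= addrK eq_sym /GRing.scale /= mulrA mulVf ?mul1r//.
by near: h; exact: nbhs_dnbhs_neq.
Unshelve. all: by end_near. Qed.

Definition slope x : R := x 0 3 / x 0 1.
Definition omega_w_coef x : R := (x 0 1)^-1 ^+ 2 + slope x ^+ 2.

Lemma is_derive_inv_coord1 x k : x 0 1 != 0 ->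
  is_derive x (delta_mx 0 k) (fun y : 'rV[R]_4 => (y 0 1)^-1)
    (- (x 0 1) ^- 2 * (k == 1)%:R).
Proof.
move=> x0; have [d1 d2] := is_derive_coord x k 1.
split; first exact: derivableV.
by rewrite deriveV// d2.
Qed.

Lemma is_derive_slope x k : x 0 1 != 0 ->
  is_derive x (delta_mx 0 k) slope
    ((x 0 1)^-1 * (k == 3)%:R - slope x / x 0 1 * (k == 1)%:R).
Proof.
move=> x0; apply: is_derive_eq.
  apply: (@is_deriveM _ _ (fun y : 'rV[R]_4 => y 0 3) (fun y => (y 0 1)^-1)).
    exact: is_derive_coord.
  exact: is_derive_inv_coord1.
by rewrite /slope /GRing.scale /=; field.
Qed.

Lemma is_derive_omega_w_coef x k : x 0 1 != 0 ->
  is_derive x (delta_mx 0 k) omega_w_coef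
    (2 * slope x / x 0 1 * (k == 3)%:R - 2 * omega_w_coef x / x 0 1 * (k == 1)%:R).
Proof.
move=> x0; pose q y : R := (y 0 1)^-1.
have -> : omega_w_coef = q * q + slope * slope.
  by apply/funext => y; rewrite /omega_w_coef !expr2.
have dq := is_derive_inv_coord1 k x0; have ds := is_derive_slope k x0.
apply: (is_derive_eq (is_deriveD (is_deriveM dq dq) (is_deriveM ds ds))).
by rewrite !fctE /q /slope /GRing.scale /=; field.
Qed.

Lemma theta1_Re x k : complex.Re (theta1 x 0 k) = (k == 0)%:R / x 0 1.
Proof.
by rewrite /theta1 mxE -fmorphV mxE /= !mxE /= mul0r subr0 mulrC eq_sym.
Qed.

Lemma theta1_Im x k : complex.Im (theta1 x 0 k) = (k == 1)%:R / x 0 1.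
Proof.
by rewrite /theta1 mxE -fmorphV mxE /= !mxE /= mul0r addr0 mulrC eq_sym.
Qed.

Lemma theta2_Re x k :
  complex.Re (theta2 x 0 k) = slope x * (k == 0)%:R - (k == 2)%:R.
Proof.
by rewrite /theta2 !mxE /= !mxE /= mul0r subr0 ![k == _]eq_sym.
Qed.

Lemma theta2_Im x k :
  complex.Im (theta2 x 0 k) = slope x * (k == 1)%:R - (k == 3)%:R.
Proof.
by rewrite /theta2 !mxE /= !mxE /= mul0r addr0 ![k == _]eq_sym.
Qed.

(** A form -i theta /\ conj theta is twice Im theta /\ Re theta. *)
Lemma omega_ReIm i j x : let im t := complex.Im (t x 0 i) * complex.Re (t x 0 j)
    - complex.Re (t x 0 i) * complex.Im (t x 0 j) in
  omega x i j = 2 * (im (@theta1 R) + im (@theta2 R)).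
Proof.
rewrite /omega /omega_complex /=; move: (theta1 x) (theta2 x) => t u.
rewrite !mxE !big_ord1 !mxE.
case: (t 0 i) (t 0 j) (u 0 i) (u 0 j) => [? ?] [? ?] [? ?] [? ?] /=; ring.
Qed.

Lemma omegaE i j x : omega x i j =
  2 * ((x 0 1)^-1 ^+ 2 * ((i == 1)%:R * (j == 0)%:R - (i == 0)%:R * (j == 1)%:R)
  + ((slope x * (i == 1)%:R - (i == 3)%:R) * (slope x * (j == 0)%:R - (j == 2)%:R)
  - (slope x * (i == 0)%:R - (i == 2)%:R) * (slope x * (j == 1)%:R - (j == 3)%:R))).
Proof.
rewrite omega_ReIm !theta1_Re !theta1_Im !theta2_Re !theta2_Im; ring.
Qed.

(** The wedge product with a nondegenerate 2-form is injective on 1-forms in real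
    dimension 4, so d omega determines the Lee form; here the four components of
    d omega = a /\ omega are solved for [a]. *)
Lemma lee_form_omega D a : lee_form D (@omega R) a ->
  forall x, HC x -> a x = eta x.
Proof.
move=> [_ _ lee] x Hx; have x0 : x 0 1 != 0 by rewrite gt_eqF.
have cst i j c : (forall y, omega y i j = c) ->
    forall k, partial k (fun y => omega y i j) x = 0.
  move=> E m; rewrite /partial (_ : (fun y => _) = cst c) ?derive_cst//.
  exact/funext.
have slp i j c : (forall y, omega y i j = c * slope y) ->
    forall k, partial k (fun y => omega y i j) x =
      c * ((x 0 1)^-1 * (k == 3)%:R - slope x / x 0 1 * (k == 1)%:R).
  move=> E m; rewrite /partial (_ : (fun y => _) = c \*: slope).
    by have [d1 d2] := is_derive_slope m x0; rewrite deriveZ// d2.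
  exact/funext.
have area i j c : (forall y, omega y i j = c * omega_w_coef y) ->
    forall k, partial k (fun y => omega y i j) x =
      c * (2 * slope x / x 0 1 * (k == 3)%:R
        - 2 * omega_w_coef x / x 0 1 * (k == 1)%:R).
  move=> E m; rewrite /partial (_ : (fun y => _) = c \*: omega_w_coef).
    by have [d1 d2] := is_derive_omega_w_coef m x0; rewrite deriveZ// d2.
  exact/funext.
have o01 y : omega y 0 1 = - 2 * omega_w_coef y.
  by rewrite omegaE /omega_w_coef /=; ring.
have o02 y : omega y 0 2 = 0 by rewrite omegaE /=; ring.
have o20 y : omega y 2 0 = 0 by rewrite omegaE /=; ring.
have o12 y : omega y 1 2 = - 2 * slope y by rewrite omegaE /=; ring.
have o13 y : omega y 1 3 = 0 by rewrite omegaE /=; ring.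
have o31 y : omega y 3 1 = 0 by rewrite omegaE /=; ring.
have o30 y : omega y 3 0 = - 2 * slope y by rewrite omegaE /=; ring.
have o23 y : omega y 2 3 = - 2 by rewrite omegaE /=; ring.
have := lee x Hx 0 1 2; have := lee x Hx 0 2 3.
have := lee x Hx 1 2 3; have := lee x Hx 0 1 3.
rewrite /ext_d2 /wedge12 !(cst _ _ _ o02, cst _ _ _ o20, cst _ _ _ o13,
  cst _ _ _ o31, cst _ _ _ o23, slp _ _ _ o12, slp _ _ _ o30, area _ _ _ o01).
rewrite !(o01, o02, o20, o12, o13, o31, o30, o23) /= /omega_w_coef.
have etaE i : eta x 0 i = (x 0 1)^-1 * (i == 1)%:R.
  by rewrite /eta !mxE /= mxE eqxx /= eq_sym.
have : (x 0 1)^-1 != 0 by rewrite invr_eq0.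
move: (x 0 1)^-1 (slope x) etaE => q u etaE q0 e013 e123 e023 e012.
have q20 : q ^+ 2 != 0 by rewrite expf_neq0.
have a2 : a x 0 2 = 0.
  apply: (mulfI q20); rewrite mulr0.
  have a0 : a x 0 0 = - (a x 0 2 * u) by lra.
  by move: e012; rewrite a0; lra.
have a0 : a x 0 0 = 0 by move: e023; rewrite a2; lra.
have a3 : a x 0 3 = 0.
  apply: (mulfI q20); rewrite mulr0.
  have a1 : a x 0 1 = q - a x 0 3 * u by lra.
  by move: e013; rewrite a1; lra.
have a1 : a x 0 1 = q by move: e123; rewrite a3; lra.
by apply: row4P; rewrite etaE ?a0 ?a1 ?a2 ?a3 /= ?mulr0 ?mulr1.
Qed.
End OmegaLee.

(** * Functions on the surface and their lifts *)

Section LocallyConstant.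
Local Open Scope quotient_scope.
Variables (R : realType) (n : nat).

Lemma near_cst_smooth (U : set 'rV[R]_n) (f : 'rV[R]_n -> R) : open U ->
  (forall x, U x -> \forall y \near x, f y = f x) -> smooth_on U f.
Proof.
move=> oU lc k; elim: k f lc => [|k IH] f lc /=.
  split=> // x Ux; apply: (@near_eq_continuous _ _ _ (cst (f x))).
    by apply: filterS (lc x Ux) => y ->.
  exact: cst_continuous.
split=> [x Ux|i].
  apply: (@near_eq_continuous _ _ _ (cst (f x))).
    by apply: filterS (lc x Ux) => y ->.
  exact: cst_continuous.
have d0 x : U x -> is_derive x (delta_mx 0 i) f 0.
  move=> Ux; apply: (@near_eq_is_derive _ _ _ (cst (f x))).
    by apply: filterS (lc x Ux) => y ->.
split; first by move=> x /d0[].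
apply: IH => x Ux; have nU : \forall y \near x, U y by exact: open_nbhs_nbhs.
apply: filterS nU => y Uy.
by rewrite /partial (@derive_val _ _ _ _ _ _ _ (d0 _ Uy))
  (@derive_val _ _ _ _ _ _ _ (d0 _ Ux)).
Qed.

End LocallyConstant.

Section Lift.
Local Open Scope quotient_scope.
Variables (R : realType) (D : inoue_data R).
Local Notation S := (inoue_surface D).
Local Notation pr := (\pi_(inoue_surface D)).

Lemma lift_fun_val (f : S -> R) (y : @HC R) : lift_fun f (set_val y) = f (pr y).
Proof. by rewrite /lift_fun /set_val /= valK. Qed.

Lemma lift_set_open (U : set S) : open U -> open (lift_set U).
Proof.
move=> oU; have [W oW WU] : open (pr @^-1` U) by [].
have -> : lift_set U = W `&` @HC R.
  apply/seteqP; split=> x /=.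
    move=> [y Uy <-]; split; last exact: set_valP.
    by have /(congr1 (fun A => A y)) /= -> := WU.
  move=> [Wx Hx]; exists (SigSub (mem_set Hx)) => //.
  by have /(congr1 (fun A => A (SigSub (mem_set Hx)))) /= <- := WU.
by apply: openI => //; exact: HC_open.
Qed.

Lemma near_lift (y : @HC R) (P : set S) :
  (\forall p \near pr y, P p) -> \forall x \near set_val y, lift_set P x.
Proof.
rewrite -nbhs_nearE nbhsE => -[U [Uop Uy] UP].
have : \forall x \near set_val y, lift_set U x.
  by apply: open_nbhs_nbhs; split; [exact: lift_set_open | exists y].
by apply: filterS => x [z Uz <-]; exists z => //; exact: UP.
Qed.

Lemma lift_locally_constant (U : set S) (f : S -> R) x : open U ->
  locally_constant_on U f -> lift_set U x ->
  \forall x' \near x, lift_fun f x' = lift_fun f x.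
Proof.
move=> oU lc [y Uy <-].
have /near_lift : \forall p \near pr y, f p = f (pr y).
  have nU : \forall p \near pr y, U p by exact: open_nbhs_nbhs.
  by apply: filterS2 nU (lc _ Uy) => p Up; exact.
by apply: filterS => x' [z fz <-]; rewrite !lift_fun_val.
Qed.

Lemma group_HC g : inoue_group D g -> forall x, HC (g x) <-> HC x.
Proof.
elim=> [|i||//|g1 g2 _ IH1 _ IH2|g1 g2 _ IH K1 K2] x.
- rewrite -(pt_eta x) phi0E !HC_pt pmulr_rgt0// (lt_trans ltr01)//.
  exact: ialpha_gt1.
- by rewrite -(pt_eta x) phiE !HC_pt.
- by rewrite -(pt_eta x) phi3E !HC_pt.
- by rewrite /= IH1.
- by rewrite -[in X in _ <-> X](K2 x) IH.
Qed.

Lemma lift_fun_invariant (f : S -> R) g : inoue_group D g ->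
  forall x, HC x -> lift_fun f (g x) = lift_fun f x.
Proof.
move=> Gg x Hx; have Hgx : HC (g x) by apply/group_HC.
have -> : x = set_val (SigSub (mem_set Hx) : @HC R) by [].
have -> : g (set_val (SigSub (mem_set Hx) : @HC R)) =
  set_val (SigSub (mem_set Hgx) : @HC R) by [].
rewrite !lift_fun_val; congr f; apply/esym/eqmodP => /=.
by apply/asboolP; exists g.
Qed.

End Lift.

(** * The conformal factor given by an isomorphism of flat bundles *)

Section Bundles.
Local Open Scope quotient_scope.
Variables (R : realType) (D : inoue_data R).
Local Notation S := (inoue_surface D).
Local Notation pr := (\pi_(inoue_surface D)).
Local Notation bundle := (flat_line_bundle R S).

Lemma trans_refl (L : bundle) i x : fl_open (f := L) i x -> fl_trans i i x = 1.
Proof.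
move=> ix; apply: (mulfI (fl_trans_neq0 ix ix)).
by rewrite mulr1 fl_cocycle.
Qed.

Lemma locally_constant_smooth (U : set S) (f : S -> R) : open U ->
  locally_constant_on U f -> smooth_surface_fun U f.
Proof.
move=> oU lc; apply: near_cst_smooth; first exact: lift_set_open.
by move=> x Ux; exact: lift_locally_constant oU lc Ux.
Qed.

(** The constant section 1 of a chart of [M] is flat, and corresponds to the section
    [k i b] of [L], which is therefore annihilated by d_L + a. *)
Lemma deformation_dlog (L M : bundle) (a : form1 R) : deformation L a M ->
  exists k : fl_index L -> fl_index M -> S -> R,
  [/\ bundle_iso k,
      forall i b, smooth_surface_fun (fl_open i `&` fl_open b) (k i b) &
      forall i b x, lift_set (fl_open i `&` fl_open b) x -> forall m,
        partial m (lift_fun (k i b)) x = - a x 0 m * lift_fun (k i b) x].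
Proof.
move=> [k [iso_k smooth_k flat_k]]; exists k; split=> // i b x ibx m.
have [_ kE] := iso_k.
have [] := flat_k (fl_open b) (fun c => fl_trans c b) (fun j => k j b) (fl_openP b).
- split=> [c|c d y by_ cy dy]; last by rewrite fl_cocycle.
  by rewrite setIC; apply: locally_constant_smooth;
    [apply: openI; exact: fl_openP | exact: fl_trans_lc].
- split=> [j|j j' y by_ jy j'y]; first by rewrite setIC.
  by rewrite -(kE j j' b b)// trans_refl// mulr1.
- by move=> j c y by_ jy cy; rewrite (kE j j c b)// trans_refl// mul1r.
move=> parallel _; have {}parallel := parallel _.
apply/eqP; rewrite mulNr -addr_eq0; apply/eqP; apply: parallel; last first.
  by rewrite setIC.
move=> c; rewrite setIC; exact: fl_trans_lc.
Qed.

(** The bundles [L0] and [M0], given by primitives [f0] and [f] of [a0] and [a], have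
    the global nowhere zero sections e^{-f0} and e^{-f}. Comparing them through the
    isomorphisms L0 ~ L ~ M ~ M0, of which the middle one is not flat but has
    logarithmic derivative [- b], yields a function on the surface with logarithmic
    derivative [a0 - b - a]. Its absolute value is the conformal factor that moves
    the Lee form [a] to [a0 - b]. *)
Section ConformalFactor.
Variables (L0 L M0 M : bundle) (a0 a b : form1 R).
Variables (f0 : fl_index L0 -> S -> R) (f : fl_index M0 -> S -> R).
Variables (k0 : fl_index L -> fl_index L0 -> S -> R)
  (k : fl_index L -> fl_index M -> S -> R)
  (k1 : fl_index M -> fl_index M0 -> S -> R).

(** The condition defining [bundle_from_primitives], with the family of primitives
    made explicit. *)
Definition primitives_of (N : bundle) (c : form1 R) (h : fl_index N -> S -> R) :=
  (forall i,
      smooth_surface_fun (fl_open i) (h i) /\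
      forall x, lift_set (fl_open i) x -> forall m,
        partial m (lift_fun (h i)) x = c x 0 m) /\
    (forall i j, exists l : R, forall x, fl_open i x -> fl_open j x ->
      h i x - h j x = l /\ fl_trans i j x = expR (- l)).

Hypotheses (prim_f0 : primitives_of a0 f0) (prim_f : primitives_of a f).
Hypotheses (iso_k0 : bundle_iso k0) (iso_k : bundle_iso k) (iso_k1 : bundle_iso k1).
Hypothesis lc_k0 :
  forall i j, locally_constant_on (fl_open i `&` fl_open j) (k0 i j).
Hypothesis lc_k1 :
  forall i j, locally_constant_on (fl_open i `&` fl_open j) (k1 i j).
Hypothesis smooth_k :
  forall i j, smooth_surface_fun (fl_open i `&` fl_open j) (k i j).
Hypothesis dlog_k : forall i j x, lift_set (fl_open i `&` fl_open j) x ->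
  forall m, partial m (lift_fun (k i j)) x = - b x 0 m * lift_fun (k i j) x.

Let T := (fl_index L * fl_index L0 * fl_index M * fl_index M0)%type.

Let chart (t : T) : set S := let '(i, j, c, d) := t in
  fl_open i `&` fl_open j `&` fl_open c `&` fl_open d.

Let ratio (t : T) (p : S) : R := let '(i, j, c, d) := t in
  expR (f0 j p) * (k0 i j p)^-1 * k i c p * k1 c d p * expR (- f d p).

Lemma primitives_trans (N : bundle) (c : form1 R) (h : fl_index N -> S -> R) i j p :
  primitives_of c h -> fl_open i p -> fl_open j p ->
  fl_trans i j p = expR (h j p) / expR (h i p).
Proof.
move=> [_ /(_ i j)[l hl]] ip jp; have [<- ->] := hl p ip jp.
by rewrite opprB expRD expRN.
Qed.

Lemma ratio_neq0 t p : chart t p -> ratio t p != 0.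
Proof.
move: t => [[[i j] c] d] /= [[[ip jp] cp] dp].
have e_neq0 x : expR x != 0 :> R by rewrite gt_eqF// expR_gt0.
by rewrite !mulf_neq0 ?invr_eq0 ?e_neq0 ?iso_k0.1 ?iso_k.1 ?iso_k1.1.
Qed.

(** The transition functions of the four bundles cancel out, so the local ratios
    glue to a function on the surface. *)
Lemma ratio_eq t t' p : chart t p -> chart t' p -> ratio t p = ratio t' p.
Proof.
move: t t' => [[[i j] c] d] [[[i' j'] c'] d'] /=.
move=> [[[ip jp] cp] dp] [[[ip' jp'] cp'] dp'].
have e_neq0 x : expR x != 0 :> R by rewrite gt_eqF// expR_gt0.
have E0 := iso_k0.2 i i' j j' p ip ip' jp jp'.
have E := iso_k.2 i i' c c' p ip ip' cp cp'.
have E1 := iso_k1.2 c c' d d' p cp cp' dp dp'.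
rewrite (primitives_trans prim_f0 jp jp') in E0.
rewrite (primitives_trans prim_f dp dp') in E1.
have tL := fl_trans_neq0 ip ip'; have tM := fl_trans_neq0 cp cp'.
have K0 := iso_k0.1 i j p ip jp.
have -> : k0 i' j' p =
    k0 i j p * (expR (f0 j' p) / expR (f0 j p)) / fl_trans i i' p.
  by rewrite E0 mulrC mulKf.
have -> : k i' c' p = k i c p * fl_trans c c' p / fl_trans i i' p.
  by rewrite E mulrC mulKf.
have -> : k1 c' d' p =
    k1 c d p * (expR (f d' p) / expR (f d p)) / fl_trans c c' p.
  by rewrite E1 mulrC mulKf.
rewrite !expRN; field.
by rewrite !e_neq0 tL tM K0.
Qed.

Lemma chart_exists p : exists t, chart t p.
Proof.
have [i ip] := fl_cover L p; have [j jp] := fl_cover L0 p.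
have [c cp] := fl_cover M p; have [d dp] := fl_cover M0 p.
by exists (i, j, c, d).
Qed.

Lemma chart_open t : open (chart t).
Proof. by move: t => [[[i j] c] d]; do 3?apply: openI; exact: fl_openP. Qed.

Definition conformal_factor (p : S) : R := `|ratio (sval (cid (chart_exists p))) p|.

Lemma conformal_factorE t p : chart t p -> conformal_factor p = `|ratio t p|.
Proof.
move=> tp; rewrite /conformal_factor; case: cid => t' /= t'p.
by rewrite (ratio_eq t'p tp).
Qed.

Lemma conformal_factor_gt0 p : 0 < conformal_factor p.
Proof.
have [t tp] := chart_exists p.
by rewrite (conformal_factorE tp) normr_gt0 ratio_neq0.
Qed.

Lemma smooth_lift (U : set S) (g : S -> R) x m : smooth_surface_fun U g ->
  lift_set U x -> {for x, continuous (lift_fun g)} /\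
    is_derive x (delta_mx 0 m) (lift_fun g) (partial m (lift_fun g) x).
Proof.
move=> /(_ 1%N)[cg /(_ m)[dg _]] Ux; split; first exact: cg.
by apply: DeriveDef => //; exact: dg.
Qed.

Lemma conformal_factor_derive x m : HC x ->
  {for x, continuous (lift_fun conformal_factor)} /\
  is_derive x (delta_mx 0 m) (lift_fun conformal_factor)
    ((a0 x 0 m - b x 0 m - a x 0 m) * lift_fun conformal_factor x).
Proof.
move=> Hx; pose y : @HC R := SigSub (mem_set Hx).
have xE : x = set_val y by [].
have [[[[i j] c] d] typ] := chart_exists (pr y).
have [[[ip jp] cp] dp] := typ.
have lc0 : \forall x' \near x, lift_fun (k0 i j) x' = k0 i j (pr y).
  rewrite -lift_fun_val; apply: (@lift_locally_constant _ _ (fl_open i `&` fl_open j)).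
  - by apply: openI; exact: fl_openP.
  - exact: lc_k0.
  - by exists y.
have lc1 : \forall x' \near x, lift_fun (k1 c d) x' = k1 c d (pr y).
  rewrite -lift_fun_val; apply: (@lift_locally_constant _ _ (fl_open c `&` fl_open d)).
  - by apply: openI; exact: fl_openP.
  - exact: lc_k1.
  - by exists y.
pose A := (k0 i j (pr y))^-1 * k1 c d (pr y).
pose v := cst A * (expR \o lift_fun (f0 j)) * lift_fun (k i c)
   * (expR \o - lift_fun (f d)).
have near_ratio : \forall x' \near x, lift_fun conformal_factor x' = `|v x'|.
  have /near_lift nt : \forall p \near pr y, chart (i, j, c, d) p.
    by apply: open_nbhs_nbhs; split; [exact: chart_open|].
  near=> x'.
  have [z tz zx'] : lift_set (chart (i, j, c, d)) x' by near: x'.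
  have l0 : lift_fun (k0 i j) x' = k0 i j (pr y) by near: x'.
  have l1 : lift_fun (k1 c d) x' = k1 c d (pr y) by near: x'.
  move: l0 l1; rewrite -zx' !lift_fun_val (conformal_factorE tz) /= => l0 l1.
  by rewrite /v /A !fctE !lift_fun_val -l1 -l0; congr `|_|; ring.
have [c0 d0] : {for x, continuous (lift_fun (f0 j))} /\
    is_derive x (delta_mx 0 m) (lift_fun (f0 j)) (a0 x 0 m).
  rewrite -((prim_f0.1 j).2 x (ex_intro2 _ _ y jp erefl)).
  exact: smooth_lift (prim_f0.1 j).1 (ex_intro2 _ _ y jp erefl).
have [c1 d1] : {for x, continuous (lift_fun (f d))} /\
    is_derive x (delta_mx 0 m) (lift_fun (f d)) (a x 0 m).
  rewrite -((prim_f.1 d).2 x (ex_intro2 _ _ y dp erefl)).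
  exact: smooth_lift (prim_f.1 d).1 (ex_intro2 _ _ y dp erefl).
have [c2 d2] : {for x, continuous (lift_fun (k i c))} /\
    is_derive x (delta_mx 0 m) (lift_fun (k i c))
    (- b x 0 m * lift_fun (k i c) x).
  have icx : lift_set (fl_open i `&` fl_open c) x by exists y.
  by rewrite -(dlog_k icx); exact: smooth_lift (smooth_k i c) icx.
have cv : {for x, continuous v}.
  do 3?[apply: continuousM] => //; first exact: cst_continuous.
    by apply: continuous_comp => //; exact: continuous_expR.
  apply: (@continuous_comp _ _ _ (- lift_fun (f d)) expR).
    exact: continuousN.
  exact: continuous_expR.
have dv : is_derive x (delta_mx 0 m) v ((a0 x 0 m - b x 0 m - a x 0 m) * v x).
  have de0 := is_derive_comp1 (is_derive_expR (lift_fun (f0 j) x)) d0.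
  have de1 := is_derive_comp1 (is_derive_expR ((- lift_fun (f d)) x)) (is_deriveN d1).
  have dA := is_derive_cst A x (delta_mx 0 m).
  apply: (is_derive_eq (is_deriveM (is_deriveM (is_deriveM dA de0) d2) de1)).
  by rewrite /v !fctE /GRing.scale /=; ring.
have hx := nbhs_singleton near_ratio.
have v0 : v x != 0.
  by rewrite -normr_gt0 -hx (lift_fun_val _ y) conformal_factor_gt0.
(* near x the absolute value is multiplication by a constant sign *)
have near_sign : \forall x' \near x, (cst (Num.sg (v x)) * v) x' =
    lift_fun conformal_factor x'.
  have nv : \forall x' \near x, `|v x - v x'| < `|v x|.
    by have /cvgrPdist_lt := cv; apply; rewrite normr_gt0.
  apply: filterS2 near_ratio nv => x' -> h; rewrite !fctE.
  have [vp|vn|v00] := ltgtP (v x) 0; last by rewrite v00 eqxx in v0.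
    move: h; rewrite (ltr0_norm vp) (ltr0_sg vp) ltr_norml => /andP[h1 h2].
    by rewrite ltr0_norm ?mulN1r//; lra.
  move: h; rewrite (gtr0_norm vn) (gtr0_sg vn) ltr_norml => /andP[h1 h2].
  by rewrite gtr0_norm ?mul1r//; lra.
split.
  apply: near_eq_continuous near_sign _; apply: continuousM => //.
  exact: cst_continuous.
apply: near_eq_is_derive near_sign _.
have dS := is_derive_cst (Num.sg (v x)) x (delta_mx 0 m).
apply: (is_derive_eq (is_deriveM dS dv)).
rewrite hx normrEsg /GRing.scale /= mulr0 addr0; ring.
Unshelve. all: by end_near. Qed.

End ConformalFactor.
End Bundles.

(** * Positivity and conformal change *)

Section Hermitian.
Variables (R : realType) (D : inoue_data R) (o g : tensor2 R).
Hypotheses (g_herm : hermitian_metric D g) (o_fund : fundamental_form o g).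

Lemma bilin_delta (M : 'M[R]_4) i j :
  bilin M (delta_mx 0 i) (delta_mx 0 j) = M i j.
Proof. by rewrite /bilin -rowE trmx_delta -colE !mxE. Qed.

Lemma complex_structure_z1 :
  complex_structure (delta_mx 0 2) = delta_mx 0 3 :> 'rV[R]_4.
Proof. by apply: row4P; rewrite !mxE /= !mxE /=; ring. Qed.

Lemma complex_structure_z2 :
  complex_structure (delta_mx 0 3) = - delta_mx 0 2 :> 'rV[R]_4.
Proof. by apply: row4P; rewrite !mxE /= !mxE /=; ring. Qed.

(** The z-line is a complex line, and a fundamental form is definite on complex
    lines. *)
Lemma fundamental_z x : HC x -> o x 2 3 < 0 /\ o x 3 2 = - o x 2 3.
Proof.
move=> Hx; have [_ gx] := g_herm; have [sym pos inv] := gx _ Hx.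
have bilinN u v : bilin (g x) u (- v) = - bilin (g x) u v.
  by rewrite /bilin linearN mulmxN mxE.
have o23 : o x 2 3 = - bilin (g x) (delta_mx 0 2) (delta_mx 0 2).
  by rewrite -bilin_delta o_fund// complex_structure_z2 bilinN.
have o32 : o x 3 2 = bilin (g x) (delta_mx 0 2) (delta_mx 0 2).
  by rewrite -bilin_delta o_fund// -[RHS]inv !complex_structure_z1.
rewrite o23 o32 opprK oppr_lt0; split=> //; apply: pos.
by apply/eqP => /rowP/(_ 2); rewrite !mxE => /eqP; rewrite oner_eq0.
Qed.

End Hermitian.

Section Rescaling.
Variables (R : realType) (D : inoue_data R) (o : tensor2 R) (a c : form1 R).
Variable h : 'rV[R]_4 -> R.
Hypothesis smooth_o : surface_tensor2 D o.
Hypothesis smooth_c : forall m x, HC x -> {for x, continuous (fun x => c x 0 m)}.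
Hypothesis h_cont : forall x, HC x -> {for x, continuous h}.
Hypothesis h_derive : forall x m, HC x ->
  is_derive x (delta_mx 0 m) h (c x 0 m * h x).
Hypothesis h_inv : forall g, inoue_group D g -> forall x, HC x -> h (g x) = h x.
Hypothesis o_lee : forall x, HC x -> forall i j k,
  ext_d2 o x i j k = wedge12 a o x i j k.

Definition rescaled : tensor2 R := fun x => h x *: o x.

Lemma rescaled_entry i j :
  (fun x => rescaled x i j) = h * (fun x => o x i j).
Proof. by apply/funext => x; rewrite !mxE. Qed.

Lemma rescaled_derive i j m x : HC x ->
  is_derive x (delta_mx 0 m) (fun x => rescaled x i j)
    (h x * partial m (fun x => o x i j) x + c x 0 m * h x * o x i j).
Proof.
move=> Hx; have dero := ((smooth_o.1 i j 1%N).2 m).1.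
rewrite rescaled_entry.
have d2 : is_derive x (delta_mx 0 m) (fun x => o x i j)
    (partial m (fun x => o x i j) x).
  by apply: DeriveDef => //; exact: dero.
apply: (is_derive_eq (is_deriveM (h_derive m Hx) d2)).
by rewrite /GRing.scale /= [X in _ + X]mulrC.
Qed.

Lemma rescaled_C1 i j : Ck_on 1 (@HC R) (fun x => rescaled x i j).
Proof.
have [cts dero] := smooth_o.1 i j 1%N.
split=> [x Hx|m].
  rewrite rescaled_entry.
  by apply: continuousM; [exact: h_cont | exact: cts].
have [_ [cdo _]] := dero m.
split; first by move=> x /(rescaled_derive i j m)[].
split=> // x Hx.
apply: (@near_eq_continuous _ _ _ (fun x =>
    h x * partial m (fun x => o x i j) x + c x 0 m * h x * o x i j)).
  have nH : \forall y \near x, HC y.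
    by apply: open_nbhs_nbhs; split => //; exact: HC_open.
  apply: filterS nH => y Hy.
  by rewrite /partial (@derive_val _ _ _ _ _ _ _ (rescaled_derive i j m Hy)).
apply: (@continuousD _ _ _ (fun x => h x * partial m (fun x => o x i j) x)).
  by apply: continuousM; [exact: h_cont | exact: cdo].
apply: (@continuousM _ _ (fun x => c x 0 m * h x)); last exact: cts.
by apply: continuousM; [exact: smooth_c | exact: h_cont].
Qed.

Lemma rescaled_inv g : inoue_group D g ->
  forall x, HC x -> pullback2 g rescaled x = rescaled x.
Proof.
move=> Gg x Hx; rewrite /pullback2 /rescaled h_inv//.
by rewrite -scalemxAr -scalemxAl -(smooth_o.2 g Gg x Hx).
Qed.

(** With dh = h c and do = a /\ o one gets d(h o) = (a + c) /\ (h o). *)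
Lemma rescaled_lee x : HC x -> forall i j k, ext_d2 rescaled x i j k =
  wedge12 (fun x => a x + c x) rescaled x i j k.
Proof.
move=> Hx i j k; rewrite /ext_d2 /partial.
rewrite !(@derive_val _ _ _ _ _ _ _ (rescaled_derive _ _ _ Hx)).
have := o_lee Hx i j k; rewrite /ext_d2 /wedge12 => E.
rewrite /rescaled !mxE.
transitivity (h x * (partial i (fun y => o y j k) x +
  partial j (fun y => o y k i) x + partial k (fun y => o y i j) x)
  + h x * (c x 0 i * o x j k + c x 0 j * o x k i + c x 0 k * o x i j)).
  by ring.
rewrite E; ring.
Qed.

End Rescaling.

Unset Implicit Arguments.

Theorem proposition7p6 (R : realType) (D : inoue_data R)
    (L : flat_line_bundle R (inoue_surface D))
    (L_ : R -> flat_line_bundle R (inoue_surface D)) :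
  corresponding_bundle (@omega R) L ->
  (forall s : R, deformation L (form1_scale s (@eta R)) (L_ s)) ->
  ~ (exists (e : R) (omega_ : R -> tensor2 R),
       [/\ 0 < e,
           smooth_family e omega_ &
           forall s : R, `|s| < e ->
             lck_structure D (omega_ s) /\
             corresponding_bundle (omega_ s) (L_ s)]).
Proof.
move=> [a0 [L0 [lee0 [f0 prim0] [k0 iso0 lc0]]]] defL [e [omega_ [e0 _ lck]]].
(* one nonzero parameter is enough; its sign selects the inequality to refute *)
pose s := e / 2; have s0 : 0 < s by rewrite divr_gt0.
have [|[smooth_o [g g_herm o_fund] _]] := lck s.
  by rewrite gtr0_norm// ltr_pdivrMr// ltr_pMr// ltr1n.
move=> [a [M0 [lee_a [f prim] [k1 iso1 lc1]]]].
have [k [iso smooth_k dlog]] := deformation_dlog (defL s).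
pose h := lift_fun (conformal_factor f0 f k0 k k1).
have hP := conformal_factor_derive prim0 prim iso0 iso iso1 lc0 lc1 smooth_k dlog.
(* the logarithmic derivative of [h], so that [a + c] is (1 - s) eta *)
pose c x := a0 x - form1_scale s (@eta R) x - a x.
have HC_val x : HC x -> exists y : @HC R, x = set_val y.
  by move=> Hx; exists (SigSub (mem_set Hx)).
have h_gt0 x : HC x -> 0 < h x.
  move=> /HC_val[y ->]; rewrite /h lift_fun_val.
  exact: (conformal_factor_gt0 prim0 prim iso0 iso iso1).
have h_cont x : HC x -> {for x, continuous h} by move=> Hx; exact: (hP x 0 Hx).1.
have h_derive x m : HC x -> is_derive x (delta_mx 0 m) h (c x 0 m * h x).
  move=> Hx; have -> : c x 0 m =
      a0 x 0 m - form1_scale s (@eta R) x 0 m - a x 0 m by rewrite /c !mxE.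
  exact: (hP x m Hx).2.
have h_inv G : inoue_group D G -> forall x, HC x -> h (G x) = h x.
  exact: lift_fun_invariant.
have a0E := lee_form_omega lee0.
have c_cont m x : HC x -> {for x, continuous (fun x => c x 0 m)}.
  move=> Hx; apply: (@near_eq_continuous _ _ _ (fun x => (1 - s) * a0 x 0 m - a x 0 m)).
    have nH : \forall y \near x, HC y.
      by apply: open_nbhs_nbhs; split => //; exact: HC_open.
    apply: filterS nH => y Hy; rewrite /c /form1_scale -a0E// !mxE; ring.
  have [[sa0 _] _ _] := lee0; have [[sa _] _ _] := lee_a.
  apply: (@continuousB _ _ _ (fun x => (1 - s) * a0 x 0 m)).
    apply: continuousM; first exact: cst_continuous.
    exact: (sa0 m 0%N).1.
  exact: (sa m 0%N).1.
have [_ _ o_lee] := lee_a.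
suff : 1 <= 1 - s by lra.
apply: (@twisted_closed_ge1 _ D (rescaled (omega_ s) h)).
- exact: (rescaled_C1 smooth_o c_cont h_cont h_derive).
- exact: (rescaled_inv smooth_o h_inv).
- move=> x Hx; have [_ E] := fundamental_z g_herm o_fund Hx.
  by rewrite !mxE E mulrN.
- move=> x Hx; have [E _] := fundamental_z g_herm o_fund Hx.
  by rewrite mxE pmulr_rlt0// h_gt0.
- move=> x Hx.
  rewrite (rescaled_lee smooth_o h_derive o_lee Hx) /wedge12.
  have acE m : (a x + c x) 0 m = (1 - s) / x 0 1 * (m == 1)%:R.
    rewrite /c /form1_scale a0E// !mxE /= mxE eqxx /= eq_sym; ring.
  by rewrite !acE /= !mulr0 !mul0r !addr0 mulr1.
Qed.
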